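(* Let $k$ be a field. (a) For any infinite-dimensional discrete $k$-vector space $\mathfrak V$, the functor $-\,\widehat\otimes^{\leftarrow}\,\mathfrak V\colon\mathsf{Top}^{\mathsf{sc}}_k\to\mathsf{Top}^{\mathsf{sc}}_k$ is not exact in the maximal exact structure on $\mathsf{Top}^{\mathsf{sc}}_k$. (b) For any infinite-dimensional discrete $k$-vector space $\mathfrak V$, the functor $-\,\widehat\otimes^!\,\mathfrak V\colon\mathsf{Top}^{\mathsf{sc}}_k\to\mathsf{Top}^{\mathsf{sc}}_k$ is not exact in the maximal exact structure on $\mathsf{Top}^{\mathsf{sc}}_k$.
   Context: All topological $k$-vector spaces ($k$ a fixed field with the discrete topology) have linear topology: open vector subspaces form a base of neighborhoods of zero. The completion of $V$ is $V^{\wedge}=\varprojlim_{U\subset V}V/U$ over the open subspaces $U$, topologized so that the kernels of the projections $V^{\wedge}\to V/U$ form a base of neighborhoods of zero. $V$ is separated (resp. complete) if $V\to V^{\wedge}$ is injective (resp. surjective). $\mathsf{Top}^{\mathsf{sc}}_k$ is the additive category of complete, separated topological $k$-vector spaces and continuous $k$-linear maps. For topological vector spaces $U$ and $V$, the topological vector spaces $U\otimes^{\leftarrow}V$ and $U\otimes^!V$ are the vector space $U\otimes_kV$ with the following linear topologies. A subspace $E\subset U\otimes_kV$ is open in $U\otimes^{\leftarrow}V$ if: there exists an open subspace $P\subset U$ with $P\otimes_kV\subset E$; and for every $u\in U$ there is an open subspace $Q_u\subset V$ with $u\otimes Q_u\subset E$. A subspace $E$ is open in $U\otimes^!V$ if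 there exist open subspaces $P\subset U$, $Q\subset V$ with $P\otimes_kV+U\otimes_kQ\subset E$. For $\mathfrak U,\mathfrak V\in\mathsf{Top}^{\mathsf{sc}}_k$ put $\mathfrak U\,\widehat\otimes^{\leftarrow}\,\mathfrak V=(\mathfrak U\otimes^{\leftarrow}\mathfrak V)^{\wedge}$ and $\mathfrak U\,\widehat\otimes^!\,\mathfrak V=(\mathfrak U\otimes^!\mathfrak V)^{\wedge}$; on morphisms, these functors are the completions of $f\otimes g$. The maximal exact structure on an additive category is its largest exact category structure in Quillen's sense (containing every other one). It exists for $\mathsf{Top}^{\mathsf{sc}}_k$; its short exact sequences are exactly the sequences $0\to\mathfrak K\overset{i}\to\mathfrak U\overset{p}\to\mathfrak C\to0$ in which $i$ is a kernel of $p$, $p$ is a cokernel of $i$, and $p$ is a surjective open map. An additive functor is exact if it takes short exact sequences to short exact sequences. *)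

(* Defs.v *)
From HB Require Import structures.
From mathcomp Require Import all_boot all_algebra generic_quotient ring_quotient.
From mathcomp Require Import boolp classical_sets functions topology.
From mathcomp.multinomials Require Import freeg.

Set Implicit Arguments.
Unset Strict Implicit.
Unset Printing Implicit Defensive.

Import GRing.Theory.
Local Open Scope classical_set_scope.
Local Open Scope ring_scope.
Local Open Scope quotient_scope.

Definition is_submod (k : fieldType) (V : lmodType k) (W : set V) : Prop :=
  W 0 /\ forall (a : k) x y, W x -> W y -> W (a *: x + y).

Definition span (k : fieldType) (V : lmodType k) (S : set V) : set V :=
  [set x | forall W : set V, is_submod W -> S `<=` W -> W x].

Definition finite_dim (k : fieldType) (V : lmodType k) : Prop :=
  exists s : seq V, span [set x | x \in s] = setT.

Section Submod.
Variables (k : fieldType) (V : lmodType k).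
Implicit Types (W : set V).

Record submod := Submod {
  submod_set :> set V;
  submodP : is_submod submod_set }.

Lemma is_submodD W x y : is_submod W -> W x -> W y -> W (x + y).
Proof. by move=> [_ h] Wx Wy; have := h 1 _ _ Wx Wy; rewrite scale1r. Qed.

Lemma is_submodZ W a x : is_submod W -> W x -> W (a *: x).
Proof. by move=> [h0 h] Wx; have := h a _ _ Wx h0; rewrite addr0. Qed.

Lemma is_submodN W x : is_submod W -> W x -> W (- x).
Proof. by move=> hW Wx; rewrite -scaleN1r; exact: is_submodZ. Qed.

Lemma is_submodB W x y : is_submod W -> W x -> W y -> W (x - y).
Proof. by move=> hW Wx Wy; apply: is_submodD => //; exact: is_submodN. Qed.

Lemma is_submodT : is_submod [set: V].
Proof. by []. Qed.

Lemma is_submodI W W' : is_submod W -> is_submod W' -> is_submod (W `&` W').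
Proof.
move=> [h0 h] [h0' h']; split=> // a x y [Wx Wx'] [Wy Wy'].
by split; [exact: h|exact: h'].
Qed.

Lemma span_submod (S : set V) : is_submod (span S).
Proof.
split=> [W [] //|a x y hx hy W hW SW].
by case: (hW) => _; apply; [exact: hx|exact: hy].
Qed.

Lemma sub_span (S : set V) : S `<=` span S.
Proof. by move=> x Sx W _; apply. Qed.

Definition submod_pred (W : submod) : {pred V} := fun x => `[< submod_set W x >].

Lemma submod_predP (W : submod) : submod_closed (submod_pred W).
Proof.
split=> [|a x y]; rewrite !unfold_in; first exact/asboolP/(submodP W).1.
by move=> /asboolP Wx /asboolP Wy; exact/asboolP/(submodP W).2.
Qed.

HB.instance Definition _ (W : submod) :=
  GRing.isSubmodClosed.Build k V (submod_pred W) (submod_predP W).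

Definition quotmod (W : submod) := Quotient.quot (submod_pred W).

HB.instance Definition _ (W : submod) := GRing.Zmodule.on (quotmod W).

Definition qproj (W : submod) (v : V) : quotmod W := \pi_(quotmod W) v.
Definition qrepr (W : submod) (q : quotmod W) : V := repr q.

Lemma qreprK (W : submod) (q : quotmod W) : qproj W (qrepr q) = q.
Proof. exact: reprK. Qed.

Lemma qprojP (W : submod) (v w : V) : qproj W v = qproj W w <-> submod_set W (v - w).
Proof.
split=> [/eqP|Wvw]; first by rewrite -Quotient.idealrBE => /asboolP.
by apply/eqP; rewrite -Quotient.idealrBE; exact/asboolP.
Qed.

Lemma qprojD (W : submod) (v w : V) : qproj W (v + w) = qproj W v + qproj W w.
Proof. by rewrite /qproj; apply: raddfD. Qed.

Lemma qproj_repr (W : submod) (v : V) : submod_set W (qrepr (qproj W v) - v).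
Proof. by apply/qprojP; rewrite qreprK. Qed.

Definition qscale (W : submod) (a : k) (q : quotmod W) : quotmod W :=
  qproj W (a *: qrepr q).

Lemma qscaleE (W : submod) a v : qscale a (qproj W v) = qproj W (a *: v).
Proof.
apply/qprojP; rewrite -scalerBr; apply: is_submodZ (submodP W) _.
exact: qproj_repr.
Qed.

Lemma qscaleA (W : submod) a b (q : quotmod W) :
  qscale a (qscale b q) = qscale (a * b) q.
Proof. by rewrite -[q]qreprK !qscaleE scalerA. Qed.

Lemma qscale1 (W : submod) : left_id 1 (@qscale W).
Proof. by move=> q; rewrite -[q]qreprK qscaleE scale1r. Qed.

Lemma qscaleDr (W : submod) : right_distributive (@qscale W) +%R.
Proof.
by move=> a q r; rewrite -[q]qreprK -[r]qreprK -qprojD !qscaleE scalerDr qprojD.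
Qed.

Lemma qscaleDl (W : submod) (q : quotmod W) :
  {morph (@qscale W)^~ q : a b / a + b}.
Proof. by move=> a b; rewrite -[q]qreprK !qscaleE scalerDl qprojD. Qed.

HB.instance Definition _ (W : submod) :=
  GRing.Zmodule_isLmodule.Build k (quotmod W)
    (@qscaleA W) (@qscale1 W) (@qscaleDr W) (@qscaleDl W).

Lemma qproj_linear (W : submod) : linear (qproj W).
Proof. by move=> a u v; rewrite qprojD -qscaleE. Qed.

HB.instance Definition _ (W : submod) :=
  GRing.isLinear.Build k V (quotmod W) _ (qproj W) (@qproj_linear W).

End Submod.

(* The map V/A -> W/B induced by a linear map f such that f(A) is contained
   in B; it is written for any f and meaningful under this inclusion only. *)
Definition quot_map (k : fieldType) (V W : lmodType k) (f : V -> W)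
    (A : submod V) (B : submod W) (q : quotmod A) : quotmod B :=
  qproj B (f (qrepr q)).

Lemma quot_mapE (k : fieldType) (V W : lmodType k) (f : {linear V -> W})
    (A : submod V) (B : submod W) v :
  A `<=` f @^-1` B -> quot_map f B (qproj A v) = qproj B (f v).
Proof.
by move=> AB; apply/qprojP; rewrite -linearB; apply: AB; exact: qproj_repr.
Qed.

HB.mixin Record isLinearTopology (k : fieldType) V
    of GRing.Lmodule k V & Topological V := {
  add_continuous : continuous (fun x : V * V => x.1 + x.2);
  scale_continuous :
    continuous (fun x : discrete_topology k * V => (x.1 : k) *: x.2);
  nbhs0_submod : forall A : set V, nbhs (0 : V) A ->
    exists W : set V, [/\ is_submod W, open W & W `<=` A] }.

#[short(type="linTopType")]
HB.structure Definition LinTop (k : fieldType) :=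
  {V of isLinearTopology k V & GRing.Lmodule k V & Topological V}.

(* The linear topology with a given base of neighborhoods of zero formed by
   subspaces. *)
HB.factory Record hasSubmodBase (k : fieldType) V of GRing.Lmodule k V := {
  submod_base : set (set V);
  submod_base_submod : forall W, submod_base W -> is_submod W;
  submod_base_ex : exists W, submod_base W;
  submod_baseI : forall W W', submod_base W -> submod_base W' ->
    exists2 W'', submod_base W'' & W'' `<=` W `&` W' }.

HB.builders Context k V of hasSubmodBase k V.

Definition nbhs_submod (x : V) : set_system V :=
  [set A | exists2 W, submod_base W & forall w, W w -> A (x + w)].

HB.instance Definition _ := hasNbhs.Build V nbhs_submod.

Let nbhs_submod_filter (x : V) : ProperFilter (nbhs x).
Proof.
apply: Build_ProperFilter_ex; last split.
- move=> A [W /submod_base_submod [W0 _] WA]; exists (x + 0); exact: WA.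
- by case: submod_base_ex => W BW; exists W.
- move=> A A' [W BW WA] [W' BW' WA'].
  have [W'' BW'' sub] := submod_baseI BW BW'.
  by exists W'' => // w /sub[/WA ? /WA' ?].
- by move=> A A' AA' [W BW WA]; exists W => // w /WA /AA'.
Qed.

Let nbhs_submod_singleton (x : V) (A : set V) : nbhs x A -> A x.
Proof.
by move=> [W /submod_base_submod [W0 _] WA]; rewrite -[x]addr0; exact: WA.
Qed.

Let nbhs_submod_nbhs (x : V) (A : set V) : nbhs x A -> nbhs x (nbhs^~ A).
Proof.
move=> [W BW WA]; exists W => // w Ww; exists W => // w' Ww'.
by rewrite -addrA; apply: WA; apply: is_submodD (submod_base_submod BW) _ _.
Qed.

HB.instance Definition _ := Nbhs_isNbhsTopological.Build V
  nbhs_submod_filter nbhs_submod_singleton nbhs_submod_nbhs.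

Let submod_add_continuous : continuous (fun x : V * V => x.1 + x.2).
Proof.
move=> [x y] A /= [W BW WA].
exists ([set z | W (z - x)], [set z | W (z - y)]).
  by split=> /=; exists W => // w Ww /=; rewrite addrC addKr.
move=> [x' y'] /= [Wx Wy].
have -> : x' + y' = (x + y) + ((x' - x) + (y' - y)).
  by rewrite addrACA !subrKC.
by apply: WA; apply: is_submodD (submod_base_submod BW) _ _.
Qed.

Let submod_scale_continuous :
  continuous (fun x : discrete_topology k * V => (x.1 : k) *: x.2).
Proof.
move=> [a x] A /= [W BW WA].
exists ([set a], [set z | W (z - x)]).
  by split=> /=; [exact: discrete_set1|exists W => // w Ww /=; rewrite addrC addKr].
move=> [_ x'] /= [-> Wx]; rewrite -[x'](subrKC x) scalerDr.
by apply: WA; apply: is_submodZ (submod_base_submod BW) _.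
Qed.

Let submod_nbhs0 (A : set V) : nbhs (0 : V) A ->
  exists W : set V, [/\ is_submod W, open W & W `<=` A].
Proof.
move=> [W BW WA]; exists W; split.
- exact: submod_base_submod.
- rewrite openE => x Wx; exists W => // w Ww.
  exact: is_submodD (submod_base_submod BW) _ _.
- by move=> w /WA; rewrite add0r.
Qed.

HB.instance Definition _ := isLinearTopology.Build k V
  submod_add_continuous submod_scale_continuous submod_nbhs0.

HB.end.

Section LinTopTheory.
Variables (k : fieldType) (V : linTopType k).

Lemma nbhs_shift (x : V) (A : set V) :
  nbhs x A <-> nbhs (0 : V) [set w | A (x + w)].
Proof.
have h (y z : V) (B : set V) : nbhs (y + z) B -> nbhs z [set w | B (y + w)].
  move=> /(add_continuous (y, z))[[P Q] /= [Py Qz] PQ].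
  by apply: filterS Qz => w Qw; apply: (PQ (y, w)); split=> //; exact: nbhs_singleton.
split=> [|hA]; first by rewrite -[x in nbhs x]addr0; exact: h.
have := h (- x) x [set w | A (x + w)]; rewrite addNr => /(_ hA).
by apply: filterS => w /=; rewrite addNKr.
Qed.

Lemma nbhs0_open (W : set V) : is_submod W -> nbhs (0 : V) W -> open W.
Proof.
move=> hW nW; rewrite openE => x Wx; apply/nbhs_shift.
by apply: filterS nW => w; exact: is_submodD.
Qed.

End LinTopTheory.

Section OpenSub.
Variables (k : fieldType) (V : linTopType k).

Lemma linear_continuous (W : linTopType k) (f : {linear V -> W}) :
  (forall B : set W, is_submod B -> open B -> open (f @^-1` B)) -> continuous f.
Proof.
move=> hf x A /= /nbhs_shift /nbhs0_submod[B [sB oB BA]].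
apply/nbhs_shift.
have : nbhs (0 : V) (f @^-1` B).
  by apply: open_nbhs_nbhs; split; [exact: hf|rewrite /= linear0; exact: sB.1].
by apply: filterS => w Bw /=; rewrite linearD; exact: BA.
Qed.

Record opensub := OpenSub {
  opensub_submod :> submod V;
  opensub_open : open (opensub_submod : set V) }.

Lemma opensubI_open (U U' : opensub) : open ((U : set V) `&` U').
Proof. by apply: openI; exact: opensub_open. Qed.

Definition opensubI (U U' : opensub) : opensub :=
  @OpenSub (Submod (is_submodI (submodP U) (submodP U'))) (opensubI_open U U').

Definition opensubT : opensub :=
  @OpenSub (Submod (is_submodT V)) openT.

End OpenSub.

Lemma is_submod_preimage (k : fieldType) (V W : lmodType k)
  (f : {linear V -> W}) (B : submod W) : is_submod (f @^-1` B).
Proof.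
split=> [|a x y] /=; first by rewrite linear0; exact: (submodP B).1.
by move=> fx fy; rewrite linearP; exact: (submodP B).2.
Qed.

Record chom (k : fieldType) (V W : linTopType k) := CHom {
  chom_fun :> V -> W;
  chom_linear : linear chom_fun;
  chom_continuous : continuous chom_fun }.

HB.instance Definition _ (k : fieldType) (V W : linTopType k) (f : chom V W) :=
  GRing.isLinear.Build k V W _ f (chom_linear f).

Section Chom.
Variable k : fieldType.
Implicit Types U V W : linTopType k.

Lemma chomP V W (f g : chom V W) : f =1 g -> f = g.
Proof.
case: f g => [f lf cf] [g lg cg] /= /funext fg; rewrite fg in lf cf *.
by congr CHom; exact: Prop_irrelevance.
Qed.

Lemma chom_id_linear V : linear (@idfun V).
Proof. by []. Qed.

Lemma chom_id_continuous V : continuous (@idfun V).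
Proof. by move=> x; exact: cvg_id. Qed.

Definition chom_id V : chom V V := CHom (@chom_id_linear V) (@chom_id_continuous V).

Lemma chom_comp_linear U V W (g : chom V W) (f : chom U V) : linear (g \o f).
Proof. by move=> a x y; rewrite /= !linearP. Qed.

Lemma chom_comp_continuous U V W (g : chom V W) (f : chom U V) :
  continuous (g \o f).
Proof.
by move=> x; apply: continuous_comp; exact: chom_continuous.
Qed.

Definition chom_comp U V W (g : chom V W) (f : chom U V) : chom U W :=
  CHom (chom_comp_linear g f) (@chom_comp_continuous _ _ _ g f).

Lemma chom_zero_linear V W : linear (fun _ : V => 0 : W).
Proof. by move=> a x y; rewrite scaler0 addr0. Qed.

Lemma chom_zero_continuous V W : continuous (fun _ : V => 0 : W).
Proof. by move=> x; exact: cvg_cst. Qed.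

Definition chom_zero V W : chom V W :=
  CHom (@chom_zero_linear V W) (@chom_zero_continuous V W).

Lemma chom_add_linear V W (f g : chom V W) : linear (fun x => f x + g x).
Proof. by move=> a x y; rewrite !linearP scalerDr addrACA. Qed.

Lemma chom_add_continuous V W (f g : chom V W) :
  continuous (fun x => f x + g x).
Proof.
move=> x; apply: (@continuous_comp _ _ _ (fun x => (f x, g x))
  (fun x : W * W => x.1 + x.2)); last exact: add_continuous.
by apply: cvg_pair; exact: chom_continuous.
Qed.

Definition chom_add V W (f g : chom V W) : chom V W :=
  CHom (chom_add_linear f g) (@chom_add_continuous _ _ f g).

Lemma opensub_preimage_open V W (f : chom V W) (U : opensub W) :
  open (f @^-1` (U : set W)).
Proof.
by apply: open_comp (opensub_open U) => x _; exact: chom_continuous.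
Qed.

Definition opensub_preimage V W (f : chom V W) (U : opensub W) : opensub V :=
  @OpenSub k V (Submod (is_submod_preimage f U)) (opensub_preimage_open f U).

End Chom.

(* The projective limit of the quotients V/U over the open subspaces U. *)
Record completion (k : fieldType) (V : linTopType k) := Completion {
  cproj : forall U : opensub V, quotmod U;
  cproj_compat : forall U U' : opensub V, U `<=` U' ->
    quot_map idfun U' (cproj U) = cproj U' }.

Section Completion.
Variables (k : fieldType) (V : linTopType k).
Local Notation VC := (completion V).

Lemma completionP (x y : VC) : (forall U, cproj x U = cproj y U) -> x = y.
Proof.
case: x y => [x hx] [y hy] /= xy.
have e : x = y by exact: functional_extensionality_dep.
by move: hx; rewrite e => hx; congr Completion; exact: Prop_irrelevance.
Qed.

Lemma quot_map_id (A B : submod V) (v : V) : A `<=` B ->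
  quot_map idfun B (qproj A v) = qproj B v.
Proof. exact: (@quot_mapE _ _ _ idfun). Qed.

HB.instance Definition _ := gen_eqMixin VC.
HB.instance Definition _ := gen_choiceMixin VC.

Lemma quot_map_idP (A B : submod V) a (q r : quotmod A) : A `<=` B ->
  quot_map idfun B (a *: q + r) = a *: quot_map idfun B q + quot_map idfun B r.
Proof.
move=> AB; rewrite -[q]qreprK -[r]qreprK -linearP !quot_map_id //.
by rewrite linearP.
Qed.

Lemma compl_zero_compat (U U' : opensub V) : U `<=` U' ->
  quot_map idfun U' (0 : quotmod U) = 0.
Proof. by move=> UU'; rewrite -(linear0 (qproj U)) quot_map_id// linear0. Qed.

Lemma compl_lin_compat a (x y : VC) (U U' : opensub V) : U `<=` U' ->
  quot_map idfun U' (a *: cproj x U + cproj y U) =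
  a *: cproj x U' + cproj y U'.
Proof. by move=> UU'; rewrite quot_map_idP// !cproj_compat. Qed.

Lemma compl_add_compat (x y : VC) (U U' : opensub V) : U `<=` U' ->
  quot_map idfun U' (cproj x U + cproj y U) = cproj x U' + cproj y U'.
Proof. by move=> UU'; have := compl_lin_compat 1 x y UU'; rewrite !scale1r. Qed.

Lemma compl_scale_compat a (x : VC) (U U' : opensub V) : U `<=` U' ->
  quot_map idfun U' (a *: cproj x U) = a *: cproj x U'.
Proof.
move=> UU'; have := compl_lin_compat a x (Completion compl_zero_compat) UU'.
by rewrite /= !addr0.
Qed.

Definition compl_zero : VC := Completion compl_zero_compat.
Definition compl_add (x y : VC) : VC := Completion (compl_add_compat x y).
Definition compl_scale a (x : VC) : VC := Completion (compl_scale_compat a x).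
Definition compl_opp (x : VC) : VC := compl_scale (-1) x.

Lemma compl_addA : associative compl_add.
Proof. by move=> x y z; apply: completionP => U; exact: addrA. Qed.
Lemma compl_addC : commutative compl_add.
Proof. by move=> x y; apply: completionP => U; exact: addrC. Qed.
Lemma compl_add0 : left_id compl_zero compl_add.
Proof. by move=> x; apply: completionP => U; exact: add0r. Qed.
Lemma compl_addN : left_inverse compl_zero compl_opp compl_add.
Proof.
by move=> x; apply: completionP => U; rewrite /= scaleN1r addNr.
Qed.

HB.instance Definition _ := GRing.isZmodule.Build VC
  compl_addA compl_addC compl_add0 compl_addN.

Lemma compl_scaleA a b (x : VC) :
  compl_scale a (compl_scale b x) = compl_scale (a * b) x.
Proof. by apply: completionP => U; exact: scalerA. Qed.
Lemma compl_scale1 : left_id 1 compl_scale.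
Proof. by move=> x; apply: completionP => U; exact: scale1r. Qed.
Lemma compl_scaleDr : right_distributive compl_scale +%R.
Proof. by move=> a x y; apply: completionP => U; exact: scalerDr. Qed.
Lemma compl_scaleDl (x : VC) : {morph compl_scale^~ x : a b / a + b}.
Proof. by move=> a b; apply: completionP => U; exact: scalerDl. Qed.

HB.instance Definition _ := GRing.Zmodule_isLmodule.Build k VC
  compl_scaleA compl_scale1 compl_scaleDr compl_scaleDl.

Lemma cproj_linear (U : opensub V) : linear (fun x : VC => cproj x U).
Proof. by []. Qed.

Lemma cprojB (U : opensub V) (x y : VC) : cproj (x - y) U = cproj x U - cproj y U.
Proof. by rewrite /= scaleN1r. Qed.

Definition compl_ker (U : opensub V) : set VC := [set x | cproj x U = 0].

Lemma compl_ker_submod (U : opensub V) : is_submod (compl_ker U).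
Proof.
split=> [//|a x y]; rewrite /compl_ker /= => -> ->.
by rewrite scaler0 addr0.
Qed.

Lemma cproj0S (U U' : opensub V) (x : VC) : U `<=` U' ->
  cproj x U = 0 -> cproj x U' = 0.
Proof. by move=> UU' xU; rewrite -(cproj_compat x UU') xU compl_zero_compat. Qed.

Lemma compl_ker_base_submod (K : set VC) : range compl_ker K -> is_submod K.
Proof. by move=> [U _ <-]; exact: compl_ker_submod. Qed.

Lemma compl_ker_base_ex : exists K, range compl_ker K.
Proof. by exists (compl_ker (opensubT V)); exists (opensubT V). Qed.

Lemma compl_ker_baseI (K K' : set VC) : range compl_ker K -> range compl_ker K' ->
  exists2 K'', range compl_ker K'' & K'' `<=` K `&` K'.
Proof.
move=> [U _ <-] [U' _ <-]; exists (compl_ker (opensubI U U')); first by eexists.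
by move=> x hx; split; apply: cproj0S hx => v [].
Qed.

HB.instance Definition _ := hasSubmodBase.Build k VC
  compl_ker_base_submod compl_ker_base_ex compl_ker_baseI.

Lemma nbhs_completion (x : VC) (A : set VC) :
  nbhs x A <-> exists U : opensub V, forall w : VC, cproj w U = 0 -> A (x + w).
Proof.
split=> [[_ [U _ <-] UA]|[U UA]]; first by exists U.
by exists (compl_ker U) => //; exists U.
Qed.

Lemma to_compl_compat (v : V) (U U' : opensub V) : U `<=` U' ->
  quot_map idfun U' (qproj U v) = qproj U' v.
Proof. exact: quot_map_id. Qed.

Definition to_compl (v : V) : VC := Completion (to_compl_compat v).

Lemma to_compl_linear : linear to_compl.
Proof. by move=> a u v; apply: completionP => U; rewrite /= linearP. Qed.

Lemma to_compl_continuous : continuous to_compl.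
Proof.
pose f : {linear V -> VC} :=
  HB.pack to_compl (GRing.isLinear.Build k V VC _ to_compl to_compl_linear).
apply: (@linear_continuous _ _ _ f) => B sB oB.
have sB' := @is_submod_preimage _ _ _ f (Submod sB).
apply: nbhs0_open => //.
have : nbhs (0 : VC) B by apply: open_nbhs_nbhs; split=> //; exact: sB.1.
move=> /nbhs_completion[U UB]; have : nbhs (0 : V) U.
  by apply: open_nbhs_nbhs; split; [exact: opensub_open|exact: (submodP U).1].
apply: filterS => u Uu /=; rewrite -[to_compl u]add0r; apply: UB => /=.
by rewrite -(linear0 (qproj U)); apply/qprojP; rewrite subr0.
Qed.

Definition completion_hom : chom V VC := CHom to_compl_linear (@to_compl_continuous).

End Completion.

Definition is_separated (k : fieldType) (V : linTopType k) : Prop :=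
  injective (@completion_hom k V).

Definition is_complete (k : fieldType) (V : linTopType k) : Prop :=
  forall y : completion V, exists x : V, completion_hom V x = y.

HB.mixin Record isCompleteSeparated (k : fieldType) V of LinTop k V := {
  lt_separated : is_separated V;
  lt_complete : is_complete V }.

#[short(type="topscType")]
HB.structure Definition TopSC (k : fieldType) :=
  {V of isCompleteSeparated k V & LinTop k V}.

Section CompletionSC.
Variables (k : fieldType) (V : linTopType k).
Local Notation VC := (completion V).

Lemma compl_ker_open (U : opensub V) : open (compl_ker U).
Proof.
apply: nbhs0_open; first exact: compl_ker_submod.
by apply/nbhs_completion; exists U => w Uw /=; rewrite add0r.
Qed.

Definition compl_ker_opensub (U : opensub V) : opensub VC :=
  @OpenSub k VC (Submod (compl_ker_submod U)) (@compl_ker_open U).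

Lemma completion_separated : is_separated VC.
Proof.
move=> x y xy; apply: completionP => U.
have /qprojP /= := congr1 (fun z => cproj z (compl_ker_opensub U)) xy.
by rewrite /compl_ker /= scaleN1r => /eqP; rewrite subr_eq0 => /eqP.
Qed.

Lemma completion_complete : is_complete VC.
Proof.
move=> z; pose r (O : opensub VC) : VC := qrepr (cproj z O).
have rE (O O' : opensub VC) : O `<=` O' -> submod_set O' (r O - r O').
  move=> OO'; apply/qprojP; rewrite [RHS]qreprK.
  by rewrite -(cproj_compat z OO') -[cproj z O]qreprK quot_map_id.
have xP (U U' : opensub V) : U `<=` U' ->
    quot_map idfun U' (cproj (r (compl_ker_opensub U)) U) =
    cproj (r (compl_ker_opensub U')) U'.
  move=> UU'; rewrite cproj_compat//; apply/eqP; rewrite -subr_eq0 -cprojB.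
  by apply/eqP/(rE (compl_ker_opensub U) (compl_ker_opensub U')) => w; exact: cproj0S.
exists (Completion xP); apply: completionP => O /=.
have : nbhs (0 : VC) O.
  by apply: open_nbhs_nbhs; split; [exact: opensub_open|exact: (submodP O).1].
move=> /nbhs_completion[U UO]; pose OU := compl_ker_opensub U.
have sub : OU `<=` O by move=> w /UO; rewrite add0r.
rewrite -(cproj_compat z sub) -[cproj z OU]qreprK quot_map_id//.
apply/qprojP/sub; rewrite /= /compl_ker /= scaleN1r.
by apply/eqP; rewrite subr_eq0.
Qed.

HB.instance Definition _ := isCompleteSeparated.Build k VC
  completion_separated completion_complete.

End CompletionSC.

Section CompletionMap.
Variables (k : fieldType) (V W : linTopType k) (f : chom V W).

Lemma compl_map_compat (x : completion V) (U U' : opensub W) : U `<=` U' ->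
  quot_map idfun U' (quot_map f U (cproj x (opensub_preimage f U))) =
  quot_map f U' (cproj x (opensub_preimage f U')).
Proof.
move=> UU'; have sub : opensub_preimage f U `<=` opensub_preimage f U'.
  by move=> v; exact: UU'.
rewrite -(cproj_compat x sub) -[cproj x (opensub_preimage f U)]qreprK.
by rewrite !quot_mapE// (quot_map_id _ sub) quot_mapE.
Qed.

Definition compl_map_fun (x : completion V) : completion W :=
  Completion (compl_map_compat x).

Lemma compl_map_linear : linear compl_map_fun.
Proof.
move=> a x y; apply: completionP => U /=.
rewrite -[cproj x _]qreprK -[cproj y _]qreprK -linearP !quot_mapE//.
by rewrite !linearP.
Qed.

Lemma compl_map_continuous : continuous compl_map_fun.
Proof.
move=> x A /= /nbhs_completion[U UA].
apply/nbhs_completion; exists (opensub_preimage f U) => w wU /=.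
have -> : compl_map_fun (x + w) = compl_map_fun x + compl_map_fun w.
  by have := compl_map_linear 1 x w; rewrite !scale1r.
apply: UA => /=; rewrite wU -(linear0 (qproj (opensub_preimage f U))).
by rewrite quot_mapE// linear0 linear0.
Qed.

Definition compl_map : chom (completion V) (completion W) :=
  CHom compl_map_linear (@compl_map_continuous).

End CompletionMap.

Section Tensor.
Variables (k : fieldType) (U V : lmodType k).
Local Notation free := {freeg (U * V) / k}.
Local Notation gen u v := (Freeg [:: (1 : k, (u, v) : U * V)] : free).

(* The tensor product is the free vector space on U * V modulo the bilinearity
   relations. *)
Definition tensor_rel : set free :=
  [set r | (exists (a : k) (u u' : U) (v : V),
              r = gen (a *: u + u') v - (a *: gen u v + gen u' v)) \/
           (exists (a : k) (u : U) (v v' : V),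
              r = gen u (a *: v + v') - (a *: gen u v + gen u v'))].

Definition tensor_submod : submod free := Submod (span_submod tensor_rel).

Definition tensor : Type := quotmod tensor_submod.

HB.instance Definition _ := GRing.Lmodule.on tensor.

Definition tens (u : U) (v : V) : tensor := qproj tensor_submod (gen u v).

Lemma tens_linearl (v : V) : linear (fun u => tens u v).
Proof.
move=> a u u'; rewrite /tens -[X in _ = X]linearP; apply/qprojP; apply: sub_span.
by left; exists a, u, u', v.
Qed.

Lemma tens_linearr (u : U) : linear (tens u).
Proof.
move=> a v v'; rewrite /tens -[X in _ = X]linearP; apply/qprojP; apply: sub_span.
by right; exists a, u, v, v'.
Qed.

HB.instance Definition _ (u : U) :=
  GRing.isLinear.Build k V tensor _ (tens u) (@tens_linearr u).

Lemma tensor_ind (P : set tensor) :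
  is_submod P -> (forall u v, P (tens u v)) -> forall t, P t.
Proof.
move=> sP hP t; rewrite -[t]qreprK -[qrepr t]freeg_sumE linear_sum.
elim/big_ind: _ => [|x y Px Py|[u v] _]; first exact: sP.1.
  exact: is_submodD.
set c := coeff _ _.
have -> : Freeg [:: (c, (u, v))] = c *: gen u v.
  by apply/eqP/freeg_eqP => z; rewrite coeffZ !coeffU mul1r.
by rewrite linearZ; exact: (is_submodZ c sP (hP u v)).
Qed.

Variables (W : lmodType k) (b : U -> V -> W).
Hypotheses (bl : forall v, linear (b^~ v)) (br : forall u, linear (b u)).

Let lift (r : free) : W := fglift (fun x => b x.1 x.2) r.

Let lift_linear : linear lift.
Proof.
move=> a x y; have hD (r s : free) : lift (r + s) = lift r + lift s.
  pose l : {additive free -> W} := HB.pack lift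
    (GRing.isZmodMorphism.Build free W lift (lift_is_additive _)).
  exact: (raddfD l).
have hU c z : lift (Freeg [:: (c, z)]) = c *: b z.1 z.2.
  exact: liftU.
have h0 : lift 0 = 0 by apply: (addrI (lift 0)); rewrite -hD !addr0.
rewrite hD; congr (_ + _); rewrite -[x]freeg_sumE scaler_sumr.
rewrite !(big_morph lift hD h0) scaler_sumr; apply: eq_bigr => z _.
set c := coeff _ _.
have -> : a *: Freeg [:: (c, z)] = Freeg [:: (a * c, z)].
  by apply/eqP/freeg_eqP => z'; rewrite coeffZ !coeffU mulrA.
by rewrite !hU scalerA.
Qed.

Let lift_lin : {linear free -> W} :=
  HB.pack lift (GRing.isLinear.Build k free W _ lift lift_linear).

Let liftB x y : lift (x - y) = lift x - lift y.
Proof. exact: (linearB lift_lin). Qed.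

Let lift_rel (r : free) : submod_set tensor_submod r -> lift r = 0.
Proof.
pose K : set free := [set r | lift r = 0].
have sK : is_submod K.
  split=> [|a x y]; first exact: (linear0 lift_lin).
  by rewrite /K /= lift_linear => -> ->; rewrite scaler0 addr0.
move=> hr; apply: (hr K sK) => {hr}r.
have gE u v : lift (gen u v) = b u v by rewrite /lift liftU scale1r.
case=> [[a [u [u' [v ->]]]]|[a [u [v [v' ->]]]]]; rewrite /K /=;
  rewrite liftB lift_linear !gE ?bl ?br subrr//.
Qed.

Definition tensor_lift (t : tensor) : W := lift (qrepr t).

Lemma tensor_liftE u v : tensor_lift (tens u v) = b u v.
Proof.
transitivity (lift (gen u v)); last by rewrite /lift liftU scale1r.
apply/eqP; rewrite -subr_eq0 -liftB; apply/eqP/lift_rel.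
exact: qproj_repr.
Qed.

Lemma tensor_lift_linear : linear tensor_lift.
Proof.
have liftP r : lift (qrepr (qproj tensor_submod r)) = lift r.
  apply/eqP; rewrite -subr_eq0 -liftB; apply/eqP/lift_rel.
  exact: qproj_repr.
move=> a s t; rewrite -[s]qreprK -[t]qreprK -linearP /tensor_lift !liftP.
exact: lift_linear.
Qed.

End Tensor.

Section TensorMap.
Variables (k : fieldType) (U V U' V' : lmodType k).
Variables (f : {linear U -> U'}) (g : {linear V -> V'}).

Let b (u : U) (v : V) : tensor U' V' := tens (f u) (g v).

Let b_linearl v : linear (b^~ v).
Proof. by move=> a u u'; rewrite /b linearP tens_linearl. Qed.

Let b_linearr u : linear (b u).
Proof. by move=> a v v'; rewrite /b !linearP. Qed.

Definition tensor_map : tensor U V -> tensor U' V' := tensor_lift b.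

Lemma tensor_mapE u v : tensor_map (tens u v) = tens (f u) (g v).
Proof. exact: tensor_liftE b_linearl b_linearr u v. Qed.

Lemma tensor_map_linear : linear tensor_map.
Proof. exact: tensor_lift_linear b_linearl b_linearr. Qed.

HB.instance Definition _ :=
  GRing.isLinear.Build k (tensor U V) (tensor U' V') _ tensor_map
    tensor_map_linear.

End TensorMap.

Section TensorTopology.
Variables (k : fieldType) (U V : linTopType k).

(* The image of P \otimes Q in U \otimes V, for subspaces P and Q. *)
Definition tensor_sub (P : set U) (Q : set V) : set (tensor U V) :=
  span [set tens p q | p in P & q in Q].

Lemma tensor_subS (P P' : set U) (Q Q' : set V) :
  P `<=` P' -> Q `<=` Q' -> tensor_sub P Q `<=` tensor_sub P' Q'.
Proof.
move=> PP' QQ' t ht; apply: ht; first exact: span_submod.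
move=> _ [p Pp [q Qq <-]]; apply: sub_span.
by exists p; [exact: PP'|exists q; [exact: QQ'|]].
Qed.

(* "left" is the topology of U \otimes^{\leftarrow} V, "shriek" that of
   U \otimes^! V. *)
Definition open_left (E : set (tensor U V)) : Prop :=
  [/\ is_submod E,
      exists P : set U, [/\ is_submod P, open P & tensor_sub P setT `<=` E] &
      forall u : U, exists Q : set V,
        [/\ is_submod Q, open Q & forall q, Q q -> E (tens u q)]].

Definition open_shriek (E : set (tensor U V)) : Prop :=
  is_submod E /\
  exists (P : set U) (Q : set V),
    [/\ is_submod P, open P, is_submod Q, open Q &
        [set s + t | s in tensor_sub P setT & t in tensor_sub setT Q] `<=` E].

Definition tensor_left : Type := tensor U V.
Definition tensor_shriek : Type := tensor U V.

HB.instance Definition _ := GRing.Lmodule.on tensor_left.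
HB.instance Definition _ := GRing.Lmodule.on tensor_shriek.

Lemma open_left_submod (E : set tensor_left) : open_left E -> is_submod E.
Proof. by case. Qed.

Lemma open_left_ex : exists E : set tensor_left, open_left E.
Proof.
exists setT; split=> // [|u]; first by exists setT; split=> //; exact: openT.
by exists setT; split=> //; exact: openT.
Qed.

Lemma open_leftI (E E' : set tensor_left) : open_left E -> open_left E' ->
  exists2 E'', open_left E'' & E'' `<=` E `&` E'.
Proof.
move=> [sE [P [sP oP PE]] hE] [sE' [P' [sP' oP' PE']] hE'].
exists (E `&` E') => //; split; first exact: is_submodI.
  exists (P `&` P'); split; [exact: is_submodI|exact: openI|move=> t ht; split].
    by apply: PE; apply: tensor_subS ht => // ? [].
  by apply: PE'; apply: tensor_subS ht => // ? [].
move=> u; have [Q [sQ oQ QE]] := hE u; have [Q' [sQ' oQ' QE']] := hE' u.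
exists (Q `&` Q'); split; [exact: is_submodI|exact: openI|].
by move=> q [/QE ? /QE' ?].
Qed.

HB.instance Definition _ := hasSubmodBase.Build k tensor_left
  open_left_submod open_left_ex open_leftI.

Lemma open_shriek_submod (E : set tensor_shriek) : open_shriek E -> is_submod E.
Proof. by case. Qed.

Lemma open_shriek_ex : exists E : set tensor_shriek, open_shriek E.
Proof. by exists setT; split=> //; exists setT, setT; split=> //; exact: openT. Qed.

Lemma open_shriekI (E E' : set tensor_shriek) :
  open_shriek E -> open_shriek E' ->
  exists2 E'', open_shriek E'' & E'' `<=` E `&` E'.
Proof.
move=> [sE [P [Q [sP oP sQ oQ PE]]]] [sE' [P' [Q' [sP' oP' sQ' oQ' PE']]]].
exists (E `&` E') => //; split; first exact: is_submodI.
exists (P `&` P'), (Q `&` Q').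
split; [exact: is_submodI|exact: openI|exact: is_submodI|exact: openI|].
move=> _ [s hs [t ht <-]]; split.
  apply: PE; exists s; first by apply: tensor_subS hs => // ? [].
  by exists t => //; apply: tensor_subS ht => // ? [].
apply: PE'; exists s; first by apply: tensor_subS hs => // ? [].
by exists t => //; apply: tensor_subS ht => // ? [].
Qed.

HB.instance Definition _ := hasSubmodBase.Build k tensor_shriek
  open_shriek_submod open_shriek_ex open_shriekI.

(* The open subspaces of the two topologies are exactly the prescribed ones. *)
Lemma open_tensor_left (E : set tensor_left) :
  is_submod E -> open E <-> open_left E.
Proof.
move=> sE; split=> [oE|hE].
  have : nbhs (0 : tensor_left) E by apply: open_nbhs_nbhs; split=> //; exact: sE.1.
  move=> [E' [_ [P [sP oP PE']] hE'] sub].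
  have E'E : E' `<=` E by move=> t /sub; rewrite add0r.
  split=> //; first by exists P; split=> // t /PE' /E'E.
  by move=> u; have [Q [sQ oQ QE]] := hE' u; exists Q; split=> // q /QE /E'E.
apply: nbhs0_open => //; exists E; first exact: hE.
by move=> t; rewrite add0r.
Qed.

Lemma open_tensor_shriek (E : set tensor_shriek) :
  is_submod E -> open E <-> open_shriek E.
Proof.
move=> sE; split=> [oE|hE].
  have : nbhs (0 : tensor_shriek) E.
    by apply: open_nbhs_nbhs; split=> //; exact: sE.1.
  move=> [E' [_ [P [Q [sP oP sQ oQ PE']]]] sub].
  have E'E : E' `<=` E by move=> t /sub; rewrite add0r.
  by split=> //; exists P, Q; split=> // t /PE' /E'E.
apply: nbhs0_open => //; exists E; first exact: hE.
by move=> t; rewrite add0r.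
Qed.

End TensorTopology.

Section TensorTopologyMap.
Variables (k : fieldType) (U V U' V' : linTopType k).
Variables (f : chom U U') (g : chom V V').
Local Notation fg := (tensor_map f g).

Lemma tensor_map_sub (P : set U') (Q : set V') (E : set (tensor U' V')) :
  is_submod E -> tensor_sub P Q `<=` E ->
  tensor_sub (f @^-1` P) (g @^-1` Q) `<=` fg @^-1` E.
Proof.
move=> sE PE t ht; apply: ht; first exact: (@is_submod_preimage _ _ _ fg (Submod sE)).
move=> _ [p Pp [q Qq <-]]; rewrite /= tensor_mapE; apply: PE; apply: sub_span.
by exists (f p) => //; exists (g q).
Qed.

Let fL : tensor_left U V -> tensor_left U' V' := fg.
Let fS : tensor_shriek U V -> tensor_shriek U' V' := fg.

Let fL_linear : linear fL. Proof. exact: tensor_map_linear. Qed.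
Let fS_linear : linear fS. Proof. exact: tensor_map_linear. Qed.

Let pre_open (X Y : linTopType k) (h : chom X Y) (B : set Y) :
  open B -> open (h @^-1` B).
Proof. by move=> oB; apply: open_comp oB => x _; exact: chom_continuous. Qed.

Let pre_submod (X Y : linTopType k) (h : chom X Y) (B : set Y) :
  is_submod B -> is_submod (h @^-1` B).
Proof. by move=> sB; exact: (@is_submod_preimage _ _ _ h (Submod sB)). Qed.

Let fg_submod (E : set (tensor U' V')) : is_submod E -> is_submod (fg @^-1` E).
Proof. by move=> sE; exact: (@is_submod_preimage _ _ _ fg (Submod sE)). Qed.

Lemma tensor_left_map_continuous : continuous fL.
Proof.
pose h : {linear tensor_left U V -> tensor_left U' V'} :=
  HB.pack fL (GRing.isLinear.Build k _ _ _ fL fL_linear).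
apply: (@linear_continuous _ _ _ h) => E sE.
move=> /(open_tensor_left sE)[_ [P [sP oP PE]] hE].
apply/(open_tensor_left (fg_submod sE)); split; first exact: fg_submod.
  exists (f @^-1` P); split; [exact: pre_submod|exact: pre_open|].
  exact: (@tensor_map_sub P setT).
move=> u; have [Q [sQ oQ QE]] := hE (f u); exists (g @^-1` Q).
split; [exact: pre_submod|exact: pre_open|].
by move=> q /QE; rewrite /= -tensor_mapE.
Qed.

Lemma tensor_shriek_map_continuous : continuous fS.
Proof.
pose h : {linear tensor_shriek U V -> tensor_shriek U' V'} :=
  HB.pack fS (GRing.isLinear.Build k _ _ _ fS fS_linear).
apply: (@linear_continuous _ _ _ h) => E sE.
move=> /(open_tensor_shriek sE)[_ [P [Q [sP oP sQ oQ PQE]]]].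
apply/(open_tensor_shriek (fg_submod sE)); split; first exact: fg_submod.
exists (f @^-1` P), (g @^-1` Q).
split; [exact: pre_submod|exact: pre_open|exact: pre_submod|exact: pre_open|].
have PE : tensor_sub P setT `<=` E.
  move=> t ht; apply: PQE; exists t => //; exists 0; last exact: addr0.
  exact: (span_submod _).1.
have QE : tensor_sub setT Q `<=` E.
  move=> t ht; apply: PQE; exists 0; first exact: (span_submod _).1.
  by exists t => //; exact: add0r.
move=> _ [s hs [t ht <-]]; apply: is_submodD (fg_submod sE) _ _.
  exact: (@tensor_map_sub P setT).
exact: (@tensor_map_sub setT Q).
Qed.

Definition tensor_left_map : chom (tensor_left U V) (tensor_left U' V') :=
  CHom fL_linear (@tensor_left_map_continuous).
Definition tensor_shriek_map : chom (tensor_shriek U V) (tensor_shriek U' V') :=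
  CHom fS_linear (@tensor_shriek_map_continuous).

End TensorTopologyMap.

Section CompletionMapTheory.
Variable k : fieldType.
Implicit Types U V W : linTopType k.

Lemma compl_mapE V W (f : chom V W) (x : completion V)
    (U : opensub W) (O : opensub V) :
  O `<=` f @^-1` U -> cproj (compl_map f x) U = quot_map f U (cproj x O).
Proof.
move=> OU; have sub : O `<=` opensub_preimage f U by [].
rewrite /= -(cproj_compat x sub) -[cproj x O]qreprK (quot_map_id _ sub).
by rewrite !quot_mapE.
Qed.

Lemma compl_map_id V : compl_map (chom_id V) = chom_id (completion V).
Proof.
apply: chomP => x; apply: completionP => U.
by rewrite (@compl_mapE _ _ _ _ _ U)// -[cproj x U]qreprK quot_mapE.
Qed.

Lemma compl_map_comp U V W (g : chom V W) (f : chom U V) :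
  compl_map (chom_comp g f) = chom_comp (compl_map g) (compl_map f).
Proof.
apply: chomP => x; apply: completionP => O.
pose O' := opensub_preimage f (opensub_preimage g O).
transitivity (quot_map (chom_comp g f) O (cproj x O')); first exact: compl_mapE.
rewrite /= -/O' -[cproj x O']qreprK.
rewrite [LHS](@quot_mapE _ _ _ (chom_comp g f))//.
by rewrite [in RHS](@quot_mapE _ _ _ f)// [RHS](@quot_mapE _ _ _ g).
Qed.

Lemma compl_map_add V W (f g : chom V W) :
  compl_map (chom_add f g) = chom_add (compl_map f) (compl_map g).
Proof.
apply: chomP => x; apply: completionP => U.
pose O := opensubI (opensub_preimage f U) (opensub_preimage g U).
have Of : O `<=` f @^-1` U by move=> v [].
have Og : O `<=` g @^-1` U by move=> v [].
have Ofg : O `<=` chom_add f g @^-1` U.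
  by move=> v [Uf Ug]; exact: is_submodD (submodP U) Uf Ug.
rewrite (compl_mapE _ Ofg) [RHS](_ : _ =
  cproj (compl_map f x) U + cproj (compl_map g x) U)//.
rewrite (compl_mapE _ Of) (compl_mapE _ Og) -[cproj x O]qreprK !quot_mapE//.
by rewrite /= linearD.
Qed.

Lemma tensor_homP (U V W : lmodType k) (f g : {linear tensor U V -> W}) :
  (forall u v, f (tens u v) = g (tens u v)) -> f =1 g.
Proof.
move=> fg t; apply: (tensor_ind (P := [set t | f t = g t])) => //.
split=> [|a x y /=]; first by rewrite /= !linear0.
by rewrite !linearP => -> ->.
Qed.

End CompletionMapTheory.

Record scFunctor (k : fieldType) := ScFunctor {
  fobj :> topscType k -> topscType k;
  fmap : forall U V : topscType k, chom U V -> chom (fobj U) (fobj V);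
  fmap_id : forall U : topscType k, fmap (chom_id U) = chom_id (fobj U);
  fmap_comp : forall (U V W : topscType k) (g : chom V W) (f : chom U V),
    fmap (chom_comp g f) = chom_comp (fmap g) (fmap f);
  fmap_add : forall (U V : topscType k) (f g : chom U V),
    fmap (chom_add f g) = chom_add (fmap f) (fmap g) }.

Section TensorFunctors.
Variables (k : fieldType) (V : linTopType k).
Implicit Types U W X : topscType k.

Let idV := chom_id V.

Let tmap_id (U : lmodType k) : tensor_map (@idfun U) (@idfun V) =1 id.
Proof.
exact: (@tensor_homP _ _ _ _ (tensor_map idfun idfun) idfun (@tensor_mapE _ _ _ _ _ idfun idfun)).
Qed.

Let tmap_comp (U W X : linTopType k) (g : chom W X) (f : chom U W) :
  tensor_map (chom_comp g f) idV =1 tensor_map g idV \o tensor_map f idV.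
Proof.
apply: (@tensor_homP _ _ _ _ (tensor_map (chom_comp g f) idV)
  (tensor_map g idV \o tensor_map f idV)%FUN) => u v.
by rewrite /= !tensor_mapE.
Qed.

Let tmap_add (U W : linTopType k) (f g : chom U W) :
  tensor_map (chom_add f g) idV =1
  (fun t => tensor_map f idV t + tensor_map g idV t).
Proof.
pose F : {linear _ -> _} := tensor_map (chom_add f g) idV.
pose A : {linear _ -> _} := tensor_map f idV.
pose B : {linear _ -> _} := tensor_map g idV.
move=> t; apply: (tensor_ind (P := [set t | F t = A t + B t])) => [|u v].
  split=> [|a x y]; rewrite /mkset; first by rewrite !linear0 addr0.
  move=> hx hy; rewrite (linearP F) (linearP A) (linearP B) hx hy.
  by rewrite scalerDr addrACA.
rewrite /F /A /B /= !tensor_mapE /=.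
by have := tens_linearl v 1 (f u) (g u); rewrite !scale1r.
Qed.

Lemma tensor_left_map_id U : tensor_left_map (chom_id U) idV = chom_id _.
Proof. by apply: chomP; exact: tmap_id. Qed.

Lemma tensor_left_map_comp U W X (g : chom W X) (f : chom U W) :
  tensor_left_map (chom_comp g f) idV =
  chom_comp (tensor_left_map g idV) (tensor_left_map f idV).
Proof. by apply: chomP; exact: tmap_comp. Qed.

Lemma tensor_left_map_add U W (f g : chom U W) :
  tensor_left_map (chom_add f g) idV =
  chom_add (tensor_left_map f idV) (tensor_left_map g idV).
Proof. by apply: chomP; exact: tmap_add. Qed.

Lemma tensor_shriek_map_id U : tensor_shriek_map (chom_id U) idV = chom_id _.
Proof. by apply: chomP; exact: tmap_id. Qed.

Lemma tensor_shriek_map_comp U W X (g : chom W X) (f : chom U W) :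
  tensor_shriek_map (chom_comp g f) idV =
  chom_comp (tensor_shriek_map g idV) (tensor_shriek_map f idV).
Proof. by apply: chomP; exact: tmap_comp. Qed.

Lemma tensor_shriek_map_add U W (f g : chom U W) :
  tensor_shriek_map (chom_add f g) idV =
  chom_add (tensor_shriek_map f idV) (tensor_shriek_map g idV).
Proof. by apply: chomP; exact: tmap_add. Qed.

Definition ctensor_left_obj U : topscType k := completion (tensor_left U V).

Definition ctensor_left_map U W (f : chom U W) :
    chom (ctensor_left_obj U) (ctensor_left_obj W) :=
  compl_map (tensor_left_map f (chom_id V)).

Definition ctensor_shriek_obj U : topscType k := completion (tensor_shriek U V).

Definition ctensor_shriek_map U W (f : chom U W) :
    chom (ctensor_shriek_obj U) (ctensor_shriek_obj W) :=
  compl_map (tensor_shriek_map f (chom_id V)).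

Lemma ctensor_left_map_id U : ctensor_left_map (chom_id U) = chom_id _.
Proof. by rewrite /ctensor_left_map tensor_left_map_id compl_map_id. Qed.

Lemma ctensor_left_map_comp U W X (g : chom W X) (f : chom U W) :
  ctensor_left_map (chom_comp g f) =
  chom_comp (ctensor_left_map g) (ctensor_left_map f).
Proof. by rewrite /ctensor_left_map tensor_left_map_comp compl_map_comp. Qed.

Lemma ctensor_left_map_add U W (f g : chom U W) :
  ctensor_left_map (chom_add f g) =
  chom_add (ctensor_left_map f) (ctensor_left_map g).
Proof. by rewrite /ctensor_left_map tensor_left_map_add compl_map_add. Qed.

Lemma ctensor_shriek_map_id U : ctensor_shriek_map (chom_id U) = chom_id _.
Proof. by rewrite /ctensor_shriek_map tensor_shriek_map_id compl_map_id. Qed.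

Lemma ctensor_shriek_map_comp U W X (g : chom W X) (f : chom U W) :
  ctensor_shriek_map (chom_comp g f) =
  chom_comp (ctensor_shriek_map g) (ctensor_shriek_map f).
Proof. by rewrite /ctensor_shriek_map tensor_shriek_map_comp compl_map_comp. Qed.

Lemma ctensor_shriek_map_add U W (f g : chom U W) :
  ctensor_shriek_map (chom_add f g) =
  chom_add (ctensor_shriek_map f) (ctensor_shriek_map g).
Proof. by rewrite /ctensor_shriek_map tensor_shriek_map_add compl_map_add. Qed.

Definition ctensor_left : scFunctor k :=
  ScFunctor ctensor_left_map_id ctensor_left_map_comp ctensor_left_map_add.

Definition ctensor_shriek : scFunctor k :=
  ScFunctor ctensor_shriek_map_id ctensor_shriek_map_comp
    ctensor_shriek_map_add.

End TensorFunctors.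

Section Exact.
Variable k : fieldType.
Implicit Types A B C X : topscType k.

Definition is_iso A B (f : chom A B) : Prop :=
  exists g : chom B A, chom_comp g f = chom_id A /\ chom_comp f g = chom_id B.

Definition is_kernel A B C (i : chom A B) (p : chom B C) : Prop :=
  chom_comp p i = chom_zero A C /\
  forall X (f : chom X B), chom_comp p f = chom_zero X C ->
    exists! g : chom X A, chom_comp i g = f.

Definition is_cokernel A B C (i : chom A B) (p : chom B C) : Prop :=
  chom_comp p i = chom_zero A C /\
  forall X (f : chom B X), chom_comp f i = chom_zero A X ->
    exists! g : chom C X, chom_comp g p = f.

(* A -- i --> B
   |f         |f'
   A' - i' -> B'  *)
Definition is_pushout A B A' B' (i : chom A B) (f : chom A A')
    (i' : chom A' B') (f' : chom B B') : Prop :=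
  chom_comp i' f = chom_comp f' i /\
  forall X (g : chom A' X) (h : chom B X), chom_comp g f = chom_comp h i ->
    exists! u : chom B' X, chom_comp u i' = g /\ chom_comp u f' = h.

(* B' - p' -> C'
   |f'        |f
   B -- p --> C   *)
Definition is_pullback B C B' C' (p : chom B C) (f : chom C' C)
    (p' : chom B' C') (f' : chom B' B) : Prop :=
  chom_comp f p' = chom_comp p f' /\
  forall X (g : chom X C') (h : chom X B), chom_comp f g = chom_comp p h ->
    exists! u : chom X B', chom_comp p' u = g /\ chom_comp f' u = h.

Definition ses_class : Type :=
  forall A B C : topscType k, chom A B -> chom B C -> Prop.

Definition inflation (E : ses_class) A B (i : chom A B) : Prop :=
  exists C (p : chom B C), E A B C i p.

Definition deflation (E : ses_class) B C (p : chom B C) : Prop :=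
  exists A (i : chom A B), E A B C i p.

(* Quillen exact structures, by the list of axioms in Buehler, Exact
   categories, Definition 2.1 (Quillen's "obscure axiom" is a consequence of
   the others). *)
Record is_exact_structure (E : ses_class) : Prop := {
  ses_kernel : forall A B C (i : chom A B) (p : chom B C),
    E A B C i p -> is_kernel i p;
  ses_cokernel : forall A B C (i : chom A B) (p : chom B C),
    E A B C i p -> is_cokernel i p;
  ses_iso : forall A B C A' B' C'
      (i : chom A B) (p : chom B C) (i' : chom A' B') (p' : chom B' C')
      (a : chom A A') (b : chom B B') (c : chom C C'),
    is_iso a -> is_iso b -> is_iso c ->
    chom_comp b i = chom_comp i' a -> chom_comp c p = chom_comp p' b ->
    E A B C i p -> E A' B' C' i' p';
  inflation_id : forall A, inflation E (chom_id A);
  deflation_id : forall A, deflation E (chom_id A);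
  inflation_comp : forall A B C (i : chom A B) (j : chom B C),
    inflation E i -> inflation E j -> inflation E (chom_comp j i);
  deflation_comp : forall A B C (p : chom A B) (q : chom B C),
    deflation E p -> deflation E q -> deflation E (chom_comp q p);
  inflation_pushout : forall A B A' (i : chom A B) (f : chom A A'),
    inflation E i -> exists B' (i' : chom A' B') (f' : chom B B'),
      is_pushout i f i' f' /\ inflation E i';
  deflation_pullback : forall B C C' (p : chom B C) (f : chom C' C),
    deflation E p -> exists B' (p' : chom B' C') (f' : chom B' B),
      is_pullback p f p' f' /\ deflation E p' }.

Definition is_maximal_exact_structure (E : ses_class) : Prop :=
  is_exact_structure E /\
  forall E' : ses_class, is_exact_structure E' ->
    forall A B C (i : chom A B) (p : chom B C), E' A B C i p -> E A B C i p.

Definition is_exact_functor (E : ses_class) (F : scFunctor k) : Prop :=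
  forall A B C (i : chom A B) (p : chom B C),
    E A B C i p -> E (F A) (F B) (F C) (fmap F i) (fmap F p).

End Exact.

Definition is_discrete (k : fieldType) (V : linTopType k) : Prop :=
  forall A : set V, open A.

(* Main.v *)
Require Import Defs.
From HB Require Import structures.
From mathcomp Require Import all_boot all_algebra.
From mathcomp Require Import boolp classical_sets functions cardinality fsbigop.
From mathcomp Require Import topology.

(** Let C be the space k^N with the product topology, and e_n its unit vectors.
    For a discrete space V, a subspace of the tensor product U (x) V is open, in
    either of the two topologies, exactly when it contains P (x) V for an open
    subspace P of U; so both completed tensor products are the limit of the
    spaces (U/P) (x) V, and a single argument serves for both functors.  When V
    is infinite-dimensional, choose independent vectors v_n in V.  The series
    of the e_n (x) v_n converges in the completion for U = C, because e_n tends
    to zero.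

    The counterexample is an open surjection p from a complete space B onto C
    for which this sum is not in the image of the completed tensor product with
    V.  Take for B the direct sum, with the box topology, of copies of k^N
    indexed by all double sequences s, and let p send the j-th unit vector of
    the copy s to the j-th row of s, truncated so that it vanishes in all
    degrees below j^2.
    - p is open (psum_open): if the image of some box contained no neighborhood
      of zero of C, there would be elements c_N outside this image, each
      vanishing in degrees below N.  The rows c_(j^2) form a double sequence s,
      and the box contains the unit vectors of large degree in the copy s, so
      that its image contains c_(j^2) for j large enough: a contradiction.
    - An element y of the completed tensor product with B only involves
      finitely many of the copies (completion_finite_support).  Indeed,
      otherwise the box topology would have an open subspace modulo which y
      still involves infinitely many copies, whereas y is represented modulo
      this subspace by a finite sum of tensors.
    - r copies of k^N reach only few directions of C: in the first (r+1)^2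
      coordinates only the rows 0, ..., r of each copy are visible, hence their
      image has dimension at most r (r + 1).  Some nonzero linear combination a
      of these coordinates vanishes on it (annihilator).  Applied to a preimage
      of the series, a gives zero; applied to the series it gives the sum of
      the a_n v_n, which is nonzero (compl_map_not_surjective).

    To conclude, p has to be a deflation of the given maximal exact structure,
    and deflations have to be surjective.  The kernel-cokernel pairs formed by a
    closed embedding and an open surjection are shown to be an exact structure
    (top_ses_exact_structure), hence contained in the maximal one; the delicate
    point is that the cokernels and pushouts involved are complete, which holds
    because completeness is inherited by extensions (te_cauchy_complete).
    Conversely a deflation p of any exact structure is surjective
    (deflation_surjective): its pullback along a map hitting z is a cokernel,
    in particular not annihilated by a nonzero map, so z has a preimage. *)

Set Implicit Arguments.
Unset Strict Implicit.
Unset Printing Implicit Defensive.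

Import GRing.Theory.
Local Open Scope classical_set_scope.
Local Open Scope ring_scope.

(** * Neighborhoods of zero and Cauchy families *)

Section LinearTopology.
Variable k : fieldType.
Implicit Types V W : linTopType k.

Lemma chom0 V W (f : chom V W) : f 0 = 0.
Proof. exact: linear0. Qed.
Lemma chomD V W (f : chom V W) x y : f (x + y) = f x + f y.
Proof. exact: linearD. Qed.
Lemma chomB V W (f : chom V W) x y : f (x - y) = f x - f y.
Proof. exact: linearB. Qed.
Lemma chomL V W (f : chom V W) a x y : f (a *: x + y) = a *: f x + f y.
Proof. exact: linearP. Qed.

Lemma opensub0 V (O : opensub V) : (O : set V) 0.
Proof. exact: (submodP O).1. Qed.

Lemma opensub_nbhs V (O : opensub V) : nbhs (0 : V) O.
Proof. by apply: open_nbhs_nbhs; split; [exact: opensub_open|exact: opensub0]. Qed.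

Lemma nbhs_opensub V (A : set V) : nbhs (0 : V) A ->
  exists O : opensub V, O `<=` A.
Proof.
move=> /nbhs0_submod[B [sB oB BA]].
by exists (@OpenSub k V (Submod sB) oB).
Qed.

Definition nbhs_osub V (W : set V) (sW : is_submod W) (nW : nbhs (0 : V) W) :
  opensub V := @OpenSub k V (Submod sW) (nbhs0_open sW nW).

Lemma chom_nbhs V W (f : chom V W) (A : set W) :
  nbhs (0 : W) A -> nbhs (0 : V) (f @^-1` A).
Proof. by move=> nA; have /= := @chom_continuous _ _ _ f 0 A; rewrite linear0; apply. Qed.

Lemma linear_nbhs0_continuous V W (f : V -> W) : linear f ->
  (forall A, nbhs (0 : W) A -> nbhs (0 : V) (f @^-1` A)) -> continuous f.
Proof.
move=> lf hf x A /= /nbhs_shift nA; apply/nbhs_shift.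
apply: filterS (hf _ nA) => w /=.
by have := lf 1 x w; rewrite !scale1r => ->.
Qed.

Definition hausdorff V := forall x : V, (forall O : opensub V, (O : set V) x) -> x = 0.

(** A family of approximations indexed by the open subspaces, in place of the
    points of the projective limit of the quotients: this spares the
    representatives of dependent quotient types. *)
Definition cauchy_complete V := forall r : opensub V -> V,
  (forall O O' : opensub V, O `<=` O' -> (O' : set V) (r O - r O')) ->
  exists x, forall O : opensub V, (O : set V) (x - r O).

Lemma hausdorff_separated V : hausdorff V -> is_separated V.
Proof.
move=> hV x y exy; apply/eqP; rewrite -subr_eq0; apply/eqP/hV => O.
by apply/qprojP; exact: (congr1 (fun z => cproj z O) exy).
Qed.

Lemma separated_hausdorff V : is_separated V -> hausdorff V.
Proof.
move=> sV x hx; apply: sV; apply: completionP => O /=.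
by apply/qprojP; rewrite subr0.
Qed.

Lemma cauchy_complete_complete V : cauchy_complete V -> is_complete V.
Proof.
move=> cV y; have [O O' OO'|x hx] := cV (fun O => qrepr (cproj y O)).
  apply/qprojP; rewrite qreprK -(cproj_compat y OO') -[in RHS](qreprK (cproj y O)).
  by rewrite quot_map_id.
exists x; apply: completionP => O /=; rewrite -[RHS]qreprK; exact/qprojP.
Qed.

Lemma complete_cauchy_complete V : is_complete V -> cauchy_complete V.
Proof.
move=> cV r hr.
have hc (O O' : opensub V) : O `<=` O' ->
    quot_map idfun O' (qproj O (r O)) = qproj O' (r O').
  by move=> OO'; rewrite quot_map_id//; apply/qprojP; exact: hr.
have [x hx] := cV (Completion hc); exists x => O.
by apply/qprojP; exact: (congr1 (fun z => cproj z O) hx).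
Qed.

(** The equality lets a space carrying maps be replaced by a bundled complete
    separated one, the maps being unchanged. *)
Lemma topsc_of V : hausdorff V -> cauchy_complete V ->
  exists W : topscType k, V = W.
Proof.
move=> /hausdorff_separated hV /cauchy_complete_complete cV.
case: V hV cV => T c hs hc.
by exists (TopSC.Pack (TopSC.Class
  (isCompleteSeparated.Axioms_ (LinTop.Defs_isLinearTopology_mixin c) hs hc))).
Qed.

Lemma topsc_hausdorff (V : topscType k) : hausdorff V.
Proof. exact: separated_hausdorff lt_separated. Qed.

Lemma topsc_cauchy_complete (V : topscType k) : cauchy_complete V.
Proof. exact: complete_cauchy_complete lt_complete. Qed.

End LinearTopology.

(** * Linear topologies on subspaces, quotients and products *)

Section Subspace.
Variable k : fieldType.

Definition subm (V : lmodType k) (W : submod V) : Type := {x : V | x \in submod_pred W}.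
Section Lmod.
Variables (V : lmodType k) (W : submod V).
HB.instance Definition _ := SubType.on (subm W).
HB.instance Definition _ := Choice.on (subm W).
HB.instance Definition _ := [SubChoice_isSubLmodule of subm W by <:].
Lemma submP (x : subm W) : submod_set W (val x).
Proof. by apply/asboolP; exact: (valP x). Qed.
Lemma mem_subm x : submod_set W x -> x \in submod_pred W.
Proof. by move=> Wx; exact/asboolP. Qed.
Definition mksub x (Wx : submod_set W x) : subm W := Sub x (mem_subm Wx).
Lemma val_mksub x (Wx : submod_set W x) : val (mksub Wx) = x.
Proof. exact: SubK. Qed.
Lemma val_submL a (x y : subm W) : val (a *: x + y) = a *: val x + val y.
Proof. by []. Qed.
End Lmod.
End Subspace.

Section Subspace.
Variables (k : fieldType) (V : linTopType k) (W : submod V).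

Definition subm_base : set (set (subm W)) :=
  [set A | is_submod A /\ exists O : opensub V, (fun x : subm W => \val x) @^-1` O `<=` A].

Lemma subm_base_submod A : subm_base A -> is_submod A.
Proof. by case. Qed.

Lemma subm_base_ex : exists A, subm_base A.
Proof. by exists setT; split=> //; exists (opensubT V). Qed.

Lemma subm_baseI A A' : subm_base A -> subm_base A' ->
  exists2 A'', subm_base A'' & A'' `<=` A `&` A'.
Proof.
move=> [sA [O OA]] [sA' [O' OA']]; exists (A `&` A') => //.
split; first exact: is_submodI.
by exists (opensubI O O') => x [Ox Ox']; split; [exact: OA|exact: OA'].
Qed.

HB.instance Definition _ := hasSubmodBase.Build k (subm W)
  subm_base_submod subm_base_ex subm_baseI.

Lemma nbhs_subm (A : set (subm W)) : nbhs (0 : subm W) A <->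
  exists2 O : set V, nbhs (0 : V) O & (fun x : subm W => \val x) @^-1` O `<=` A.
Proof.
split=> [[A' [_ [O OA']] A'A]|[B /nbhs_opensub[O OB] BA]].
  exists O; first exact: opensub_nbhs.
  by move=> x /OA' /A'A; rewrite add0r.
exists ((fun x : subm W => \val x) @^-1` O).
  split; last by exists O.
  split=> [|a x y] /=; first exact: (submodP O).1.
  exact: (submodP O).2.
by move=> x /OB /BA; rewrite add0r.
Qed.

Lemma subm_val_linear : linear (fun x : subm W => \val x).
Proof. by []. Qed.

Lemma subm_val_continuous : continuous (fun x : subm W => \val x).
Proof.
apply: linear_nbhs0_continuous => // A nA.
by apply/nbhs_subm; exists A.
Qed.

Definition subm_incl : chom (subm W) V :=
  CHom subm_val_linear subm_val_continuous.

End Subspace.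

Section Quotient.
Variables (k : fieldType) (V : linTopType k) (W : submod V).

(** The quotient topology: the images of the open subspaces are exactly the
    subspaces with open preimage, and the latter form is stable under
    intersection without computation. *)
Definition quot_base : set (set (quotmod W)) :=
  [set A | is_submod A /\ nbhs (0 : V) (qproj W @^-1` A)].

Lemma quot_base_submod A : quot_base A -> is_submod A.
Proof. by case. Qed.

Lemma quot_base_ex : exists A, quot_base A.
Proof. by exists setT; split=> //; exact: filterT. Qed.

Lemma quot_baseI A A' : quot_base A -> quot_base A' ->
  exists2 A'', quot_base A'' & A'' `<=` A `&` A'.
Proof.
move=> [sA nA] [sA' nA']; exists (A `&` A') => //.
split; first exact: is_submodI.
exact: filterI.
Qed.

HB.instance Definition _ := hasSubmodBase.Build k (quotmod W)
  quot_base_submod quot_base_ex quot_baseI.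

Lemma nbhs_quot (A : set (quotmod W)) :
  nbhs (0 : quotmod W) A <-> nbhs (0 : V) (qproj W @^-1` A).
Proof.
split=> [[A' [_ nA'] A'A]|/nbhs_opensub[O OA]].
  by apply: filterS nA' => x /A'A; rewrite add0r.
exists (qproj W @` O); last by move=> _ [x Ox <-]; rewrite add0r; exact: OA.
split; first split.
- by exists 0; [exact: opensub0|rewrite linear0].
- move=> a _ _ [x Ox <-] [y Oy <-]; exists (a *: x + y); last exact: linearP.
  exact: (submodP O).2.
- by apply: filterS (opensub_nbhs O) => x Ox; exists x.
Qed.

Lemma quot_proj_continuous : continuous (qproj W).
Proof.
by apply: linear_nbhs0_continuous; [exact: qproj_linear|move=> A /nbhs_quot].
Qed.

Definition quot_chom : chom V (quotmod W) :=
  CHom (@qproj_linear k V W) quot_proj_continuous.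

End Quotient.

(** An alias, so that the product carries the linear topology constructed below
    rather than the product topology found on pairs. *)
Definition lprod (k : fieldType) (U V : lmodType k) : Type := (U * V)%type.
HB.instance Definition _ (k : fieldType) (U V : lmodType k) :=
  GRing.Lmodule.copy (lprod U V) (U * V)%type.

Section Product.
Variables (k : fieldType) (U V : linTopType k).

Definition lprod_base : set (set (lprod U V)) :=
  [set A | is_submod A /\ exists O : opensub U, exists O' : opensub V,
     O `*` O' `<=` A].

Lemma lprod_base_submod A : lprod_base A -> is_submod A.
Proof. by case. Qed.

Lemma lprod_base_ex : exists A, lprod_base A.
Proof. by exists setT; split=> //; exists (opensubT U), (opensubT V). Qed.

Lemma lprod_baseI A A' : lprod_base A -> lprod_base A' ->
  exists2 A'', lprod_base A'' & A'' `<=` A `&` A'.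
Proof.
move=> [sA [O [P OA]]] [sA' [O' [P' OA']]]; exists (A `&` A') => //.
split; first exact: is_submodI.
exists (opensubI O O'), (opensubI P P') => x [[? ?] [? ?]].
by split; [exact: OA|exact: OA'].
Qed.

HB.instance Definition _ := hasSubmodBase.Build k (lprod U V)
  lprod_base_submod lprod_base_ex lprod_baseI.

Lemma nbhs_lprod (A : set (lprod U V)) : nbhs (0 : lprod U V) A <->
  exists O O', [/\ nbhs (0 : U) O, nbhs (0 : V) O' & O `*` O' `<=` A].
Proof.
split=> [[A' [_ [O [O' OA']]] A'A]|[B [B' [/nbhs_opensub[O OB]
    /nbhs_opensub[O' OB'] BA]]]].
  exists O, O'; split; [exact: opensub_nbhs|exact: opensub_nbhs|].
  by move=> x /OA' /A'A; rewrite add0r.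
exists (O `*` O' : set (lprod U V)).
  split; last by exists O, O'.
  split=> [|a x y]; first by split; exact: opensub0.
  by move=> [? ?] [? ?]; split; [exact: (submodP O).2|exact: (submodP O').2].
by move=> [x y] [/OB ? /OB' ?]; rewrite add0r; exact: BA.
Qed.

Lemma lprod_fst_continuous : continuous (fun x : lprod U V => x.1).
Proof.
apply: linear_nbhs0_continuous; first by [].
move=> A nA; apply/nbhs_lprod.
by exists A, setT; split=> //; [exact: filterT|move=> x []].
Qed.
Definition lprod_fst : chom (lprod U V) U :=
  @CHom k (lprod U V) U (fun x => x.1) (fun _ _ _ => erefl) lprod_fst_continuous.

Lemma lprod_snd_continuous : continuous (fun x : lprod U V => x.2).
Proof.
apply: linear_nbhs0_continuous; first by [].
move=> A nA; apply/nbhs_lprod.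
by exists setT, A; split=> //; [exact: filterT|move=> x []].
Qed.
Definition lprod_snd : chom (lprod U V) V :=
  @CHom k (lprod U V) V (fun x => x.2) (fun _ _ _ => erefl) lprod_snd_continuous.

End Product.

(** * Topologically exact sequences and their extensions *)

Section TopExact.
Variable k : fieldType.

(** The algebraic exactness of the sequence, together with the conditions that
    i is a homeomorphism onto its image and that p is open.  The spaces are
    arbitrary ones because the completeness of a quotient is deduced from such
    a sequence. *)
Record top_exact (A B C : linTopType k) (i : chom A B) (p : chom B C) : Prop :=
  TopExact {
    te_inj : injective i;
    te_ker : forall b, p b = 0 <-> exists a, i a = b;
    te_emb : forall U : set A, nbhs (0 : A) U ->
      exists2 O : set B, nbhs (0 : B) O & i @^-1` O `<=` U;
    te_surj : forall c, exists b, p b = c;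
    te_open : forall O : set B, nbhs (0 : B) O -> nbhs (0 : C) (p @` O) }.

Section Factor.
Variables (A B C X : linTopType k) (i : chom A B) (p : chom B C).
Hypothesis ip : top_exact i p.

Lemma te_comp a : p (i a) = 0.
Proof. by apply/(te_ker ip); exists a. Qed.

Lemma te_factor (f : chom X B) : (forall x, p (f x) = 0) ->
  exists g : chom X A, forall x, i (g x) = f x.
Proof.
move=> pf; have /choice[g ig] : forall x, exists a, i a = f x.
  by move=> x; exact/(te_ker ip).
have lg : linear g.
  by move=> a x y; apply: (te_inj ip); rewrite chomL !ig chomL.
suff cg : continuous g by exists (CHom lg cg).
apply: (linear_nbhs0_continuous lg) => U /(te_emb ip)[O nO OU].
by apply: filterS (chom_nbhs f nO) => x Ox; apply: OU; rewrite /= ig.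
Qed.

Lemma te_descend (f : chom B X) : (forall a, f (i a) = 0) ->
  exists g : chom C X, forall b, g (p b) = f b.
Proof.
move=> fi; have /choice[s ps] := te_surj ip.
pose g c := f (s c).
have gp b : g (p b) = f b.
  apply/eqP; rewrite -subr_eq0 -chomB; apply/eqP.
  have /(te_ker ip)[a <-] : p (s (p b) - b) = 0 by rewrite chomB ps subrr.
  exact: fi.
have lg : linear g.
  by move=> a x y; rewrite -{1}(ps x) -{1}(ps y) -chomL gp chomL.
suff cg : continuous g by exists (CHom lg cg).
apply: (linear_nbhs0_continuous lg) => U nU.
apply: filterS (te_open ip (chom_nbhs f nU)) => _ [b fb <-].
by rewrite /= gp.
Qed.

End Factor.

Section Extension.
Variables (A B C : linTopType k) (i : chom A B) (p : chom B C).
Hypothesis ip : top_exact i p.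

Lemma te_hausdorff : hausdorff A -> hausdorff C -> hausdorff B.
Proof.
move=> hA hC b hb; have /(te_ker ip)[a ab] : p b = 0.
  by apply: hC => O; exact: (hb (opensub_preimage p O)).
rewrite -ab (hA a) ?chom0// => U.
have [O nO OU] := te_emb ip (opensub_nbhs U).
have [O' O'O] := nbhs_opensub nO.
by apply: OU; apply: O'O; rewrite ab; exact: hb.
Qed.

(** The image in C of a Cauchy family r of B has a limit; if b lifts it, then b
    lies in r O + O + i(A) for every O, because p O is open.  The corrections in
    A form a Cauchy family since A has the topology induced by B, and
    subtracting their limit from b gives the limit of r. *)
Lemma te_cauchy_complete : cauchy_complete A -> cauchy_complete C ->
  cauchy_complete B.
Proof.
move=> cA cC r hr.
have [D D' DD'|c hc] := cC (fun D => p (r (opensub_preimage p D))).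
  rewrite -chomB; apply: (hr (opensub_preimage p D) (opensub_preimage p D')) => x.
  exact: DD'.
have [b pb] := te_surj ip c.
(* a O is the correction: b - i (a O) approximates r O modulo O. *)
have h1 (O : opensub B) : exists a, (O : set B) (b - r O - i a).
  have sO : is_submod (p @` O).
    split=> [|x _ _ [y Oy <-] [z Oz <-]].
      by exists 0; [exact: opensub0|rewrite chom0].
    by exists (x *: y + z); [exact: (submodP O).2|exact: chomL].
  pose D := nbhs_osub sO (te_open ip (opensub_nbhs O)).
  have [o Oo po] := hc D.
  have [|o' Oo' po'] := hr O (opensub_preimage p D).
    by move=> x Ox; exists x.
  have /(te_ker ip)[a ia] : p (b - r O - (o - o')) = 0.
    by rewrite chomB [p (o - o')]chomB po po' -pb -!chomB
      [- (r O - _)]opprB subrKA subrr chom0.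
  exists a; rewrite ia opprB addrC subrK.
  exact: is_submodB (submodP O) Oo Oo'.
have [a ha] := choice h1.
have h2 (O O' : opensub B) : O `<=` O' -> (O' : set B) (i (a O - a O')).
  move=> OO'; have -> : i (a O - a O') =
      (b - r O' - i (a O')) - (b - r O - i (a O)) - (r O - r O').
    rewrite chomB -[b - r O' - _]addrA -[b - r O - _]addrA -!opprD.
    rewrite opprB [b - _ + _]addrC subrKA.
    by rewrite opprD addrACA [RHS]addrC addKr.
  have sO' := submodP O'; apply: is_submodB (hr _ _ OO') => //.
  by apply: is_submodB => //; apply: OO'.
(* The Cauchy family in A is reindexed by choosing, for each open subspace of
   A, an open subspace of B inducing a smaller one. *)
have /choice[w hw] (U : opensub A) : exists O : opensub B, i @^-1` O `<=` U.
  have [O /nbhs_opensub[O' O'O] OU] := te_emb ip (opensub_nbhs U).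
  by exists O' => x /O'O /OU.
have h3 (U : opensub A) (O : opensub B) : i @^-1` O `<=` U ->
    (U : set A) (a (w U) - a O).
  move=> OU; pose O' := opensubI (w U) O.
  have -> : a (w U) - a O = (a O' - a O) - (a O' - a (w U)).
    by rewrite opprB [RHS]addrC subrKA.
  apply: (is_submodB (submodP U)); [apply: OU|apply: hw];
    by apply: h2 => x [].
have [U U' UU'|a0 ha0] := cA (fun U => a (w U)).
  rewrite -opprB; apply: (is_submodN (submodP U')); apply: h3 => x.
  by move=> /hw /UU'.
exists (b - i a0) => O.
have -> : b - i a0 - r O = (b - r O - i (a O)) - i (a0 - a O).
  by rewrite chomB opprB addrA subrK addrAC.
apply: (is_submodB (submodP O)) => //.
pose U := opensub_preimage i O.
have -> : a0 - a O = (a0 - a (w U)) + (a (w U) - a O) by rewrite subrKA.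
rewrite chomD; apply: (is_submodD (submodP O)); first exact: (ha0 U).
exact: (h3 U).
Qed.

End Extension.
End TopExact.

(** * Kernels, quotients and products *)

Section Constructions.
Variable k : fieldType.

Lemma chom_subE (V W : linTopType k) (f g : chom V W) :
  exists h : chom V W, forall x, h x = f x - g x.
Proof.
have lh : linear (fun x => f x - g x).
  by move=> a x y; rewrite !chomL scalerBr opprD addrACA.
suff ch : continuous (fun x => f x - g x) by exists (CHom lh ch).
apply: (linear_nbhs0_continuous lh) => U /nbhs_opensub[O OU].
apply: filterS (filterI (opensub_nbhs (opensub_preimage f O))
  (opensub_nbhs (opensub_preimage g O))) => x [fx gx].
exact/OU/(is_submodB (submodP O)).
Qed.

(** The kernel of p is closed, C being separated, so the limit in B of a Cauchy
    family of the kernel stays in the kernel. *)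
Lemma ker_topsc (B C : topscType k) (p : chom B C) :
  (forall c, exists b, p b = c) ->
  (forall O : set B, nbhs (0 : B) O -> nbhs (0 : C) (p @` O)) ->
  exists (A : topscType k) (i : chom A B), top_exact i p.
Proof.
move=> sp op.
have sW : is_submod [set b | p b = 0].
  by split=> [|a x y] /=; rewrite ?chom0// chomL => -> ->; rewrite scaler0 addr0.
pose W := Submod sW.
have ex : top_exact (subm_incl W) p.
  split=> // [b|U /nbhs_subm[O nO OU]].
  - split=> [pb|[x <-]]; last exact: (submP x).
    by exists (mksub (W := W) pb); exact: val_mksub.
  - by exists O.
have hA : hausdorff (subm W).
  move=> x hx; apply: (te_inj ex); rewrite chom0; apply: topsc_hausdorff => O.
  exact: (hx (opensub_preimage (subm_incl W) O)).
have cA : cauchy_complete (subm W).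
  move=> r hr; pose P := opensub_preimage (subm_incl W).
  have [O O' OO'|b hb] := @topsc_cauchy_complete _ B (fun O => subm_incl W (r (P O))).
    by rewrite -chomB; apply: (hr (P O) (P O')) => x; exact: OO'.
  have pb : p b = 0.
    apply: topsc_hausdorff => O; have := hb (opensub_preimage p O).
    by rewrite /= [p (_ - _)]chomB (te_comp ex) subr0.
  have [x xb] := (te_ker ex b).1 pb; exists x => U.
  have [O /nbhs_opensub[O' O'O] OU] := te_emb ex (opensub_nbhs U).
  have O'U : P O' `<=` U by move=> y /O'O /OU.
  have -> : x - r U = (x - r (P O')) + (r (P O') - r U) by rewrite subrKA.
  apply: (is_submodD (submodP U)); last exact: hr.
  by apply: O'U; have := hb O'; rewrite -xb.
move: (subm_incl W) ex; have [A ->] := topsc_of hA cA => i ex.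
by exists A, i.
Qed.

Lemma quotient_exact (A B : linTopType k) (i : chom A B) : injective i ->
  (forall U : set A, nbhs (0 : A) U ->
      exists2 O : set B, nbhs (0 : B) O & i @^-1` O `<=` U) ->
  exists (C : linTopType k) (p : chom B C), top_exact i p.
Proof.
move=> injI embI; have sW : is_submod (range i).
  split=> [|a _ _ [x _ <-] [y _ <-]]; first by exists 0; rewrite ?chom0.
  by exists (a *: x + y); rewrite ?chomL.
pose W := Submod sW; exists (quotmod W), (quot_chom W).
have projE b : quot_chom W b = 0 <-> exists a, i a = b.
  rewrite /= -(linear0 (qproj W)); split=> [/qprojP|[a <-]].
    by rewrite subr0 => -[a _ <-]; exists a.
  by apply/qprojP; rewrite subr0; exists a.
split=> // [c|O nO]; first by exists (qrepr c); exact: qreprK.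
by apply/nbhs_quot; apply: filterS nO => x Ox; exists x.
Qed.

(** What is used of a product, without mention of the underlying type: the
    existence statement below can then range over bundled complete spaces. *)
Record is_product (A B P : linTopType k) (f : chom P A) (g : chom P B) : Prop :=
  IsProduct {
    prod_ext : forall x y, f x = f y -> g x = g y -> x = y;
    prod_ex : forall a b, exists x, f x = a /\ g x = b;
    prod_nbhs : forall U : set P, nbhs (0 : P) U -> exists O O',
      [/\ nbhs (0 : A) O, nbhs (0 : B) O' &
          forall x, O (f x) -> O' (g x) -> U x] }.

Lemma product_pair (A B P X : linTopType k) (f : chom P A) (g : chom P B)
    (u : chom X A) (v : chom X B) : is_product f g ->
  exists h : chom X P, forall x, f (h x) = u x /\ g (h x) = v x.
Proof.
move=> fg; have /choice[h hE] x := prod_ex fg (u x) (v x).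
have fh x : f (h x) = u x by case: (hE x).
have gh x : g (h x) = v x by case: (hE x).
have lh : linear h.
  by move=> a x y; apply: (prod_ext fg); rewrite chomL ?fh ?gh chomL.
suff ch : continuous h by exists (CHom lh ch).
apply: (linear_nbhs0_continuous lh) => U /(prod_nbhs fg)[O [O' [nO nO' OU]]].
apply: filterS (filterI (chom_nbhs u nO) (chom_nbhs v nO')) => x [ux vx].
by apply: OU; rewrite ?fh ?gh.
Qed.

(** The product is an extension of B by A. *)
Lemma product_topsc (A B : topscType k) :
  exists (P : topscType k) (f : chom P A) (g : chom P B), is_product f g.
Proof.
pose f := lprod_fst A B; pose g := lprod_snd A B.
have fg : is_product f g.
  split=> [[? ?] [? ?] /= -> -> //|a b|U /nbhs_lprod[O [O' [nO nO' OU]]]].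
    by exists (a, b).
  by exists O, O'; split=> // x Ox O'x; exact: OU.
have [i iE] := product_pair (chom_id A) (chom_zero A B) fg.
have ex : top_exact i g.
  split=> [x y xy|b|U nU|c|O /nbhs_lprod[O1 [O2 [n1 n2 OO]]]].
  - by rewrite -[x]/(chom_id A x) -(iE x).1 xy (iE y).1.
  - split=> [gb|[a <-]]; last by have [_ ->] := iE a.
    exists (f b); have [fE gE] := iE (f b).
    by apply: (prod_ext fg); rewrite ?fE ?gE ?gb.
  - exists (f @^-1` U); first exact: chom_nbhs.
    by move=> x; rewrite -[U x]/(U (chom_id A x)) -(iE x).1.
  - by exists (0, c).
  - apply: filterS n2 => c Oc; exists (0, c) => //; apply: OO; split=> //=.
    exact: nbhs_singleton n1.
have := te_hausdorff ex (@topsc_hausdorff _ A) (@topsc_hausdorff _ B).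
have := te_cauchy_complete ex (@topsc_cauchy_complete _ A)
  (@topsc_cauchy_complete _ B).
clear i iE ex; move: f g fg; move: (lprod A B : linTopType k) => P f g fg cP hP.
have [P' eP] := topsc_of hP cP; subst P.
by exists P', f, g.
Qed.

End Constructions.

(** * The exact structure of closed embeddings and open surjections *)

Section ExactStructure.
Variable k : fieldType.
Implicit Types A B C : topscType k.

Lemma chom_eq (V W : linTopType k) (f g : chom V W) : f = g -> forall x, f x = g x.
Proof. by move=> ->. Qed.

Definition top_ses : ses_class k := fun A B C i p => top_exact i p.

Lemma top_ses_kernel A B C (i : chom A B) (p : chom B C) :
  top_exact i p -> is_kernel i p.
Proof.
move=> ip; split=> [|X f /chom_eq pf]; first by apply: chomP => a; exact: te_comp.
have [g ig] := te_factor ip pf; exists g; split; first exact: chomP.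
by move=> g' ig'; apply: chomP => x; apply: (te_inj ip); rewrite ig -ig'.
Qed.

Lemma top_ses_cokernel A B C (i : chom A B) (p : chom B C) :
  top_exact i p -> is_cokernel i p.
Proof.
move=> ip; split=> [|X f /chom_eq fi]; first by apply: chomP => a; exact: te_comp.
have [g gp] := te_descend ip fi; exists g; split; first exact: chomP.
by move=> g' gp'; apply: chomP => c; have [b <-] := te_surj ip c; rewrite gp -gp'.
Qed.

Lemma top_ses_iso A B C A' B' C' (i : chom A B) (p : chom B C)
    (i' : chom A' B') (p' : chom B' C')
    (a : chom A A') (b : chom B B') (c : chom C C') :
  is_iso a -> is_iso b -> is_iso c ->
  chom_comp b i = chom_comp i' a -> chom_comp c p = chom_comp p' b ->
  top_exact i p -> top_exact i' p'.
Proof.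
move=> [a' [/chom_eq a'a /chom_eq aa']] [b' [/chom_eq b'b /chom_eq bb']].
move=> [c' [/chom_eq c'c /chom_eq cc']] /chom_eq bi /chom_eq cp ip.
rewrite /= in a'a aa' b'b bb' c'c cc' bi cp.
have i'E x : i' x = b (i (a' x)) by rewrite bi aa'.
have p'E y : p' y = c (p (b' y)) by rewrite cp bb'.
split=> [x y|y|U nU|z|O nO].
- rewrite !i'E => /(can_inj b'b)/(te_inj ip)/(can_inj aa'). exact.
- rewrite p'E; split=> [y0|[x <-]].
    have /(te_ker ip)[x ix] : p (b' y) = 0 by rewrite -[LHS]c'c y0 chom0.
    by exists (a x); rewrite -bi ix bb'.
  by rewrite i'E b'b (te_comp ip) chom0.
- have [O nO OU] := te_emb ip (chom_nbhs a nU).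
  exists (b' @^-1` O); first exact: chom_nbhs.
  by move=> x /=; rewrite i'E b'b => /OU /=; rewrite aa'.
- have [y py] := te_surj ip (c' z); exists (b y).
  by rewrite p'E b'b py cc'.
- apply: filterS (chom_nbhs c' (te_open ip (chom_nbhs b nO))).
  by move=> z [y Oy pz]; exists (b y); rewrite // p'E b'b pz cc'.
Qed.

Lemma zero_topsc A : exists Z : topscType k, forall z : Z, z = 0.
Proof.
have [|O nO|Z [i ex]] := @ker_topsc _ _ _ (chom_id A).
- by move=> a; exists a.
- by apply: filterS nO => x Ox; exists x.
by exists Z => z; apply: (te_inj ex); rewrite chom0; exact: (te_comp ex z).
Qed.

Lemma top_ses_inflation_id A : inflation top_ses (chom_id A).
Proof.
have [Z Z0] := zero_topsc A; exists Z, (chom_zero A Z); split=> //.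
- by move=> b; split=> // _; exists b.
- by move=> U nU; exists U.
- by move=> c; exists 0; rewrite [RHS]Z0.
- move=> O nO; suff -> : chom_zero A Z @` O = setT by exact: filterT.
  apply/seteqP; split=> // z _; exists 0; last by rewrite [RHS]Z0.
  exact: nbhs_singleton nO.
Qed.

Lemma top_ses_deflation_id A : deflation top_ses (chom_id A).
Proof.
apply: ker_topsc => [a|O nO]; first by exists a.
by apply: filterS nO => x Ox; exists x.
Qed.

Lemma top_ses_extension A C (G : linTopType k) (i : chom A G) (p : chom G C) :
  top_exact i p -> exists G' : topscType k, G = G'.
Proof.
move=> ip; apply: topsc_of.
- exact: te_hausdorff ip (@topsc_hausdorff _ A) (@topsc_hausdorff _ C).
- exact: te_cauchy_complete ip (@topsc_cauchy_complete _ A)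
    (@topsc_cauchy_complete _ C).
Qed.

(** For i : A -> B and j : B -> C, the cokernel C / A is an extension of C / B
    by B / A, hence complete. *)
Lemma top_ses_inflation_comp A B C (i : chom A B) (j : chom B C) :
  inflation top_ses i -> inflation top_ses j -> inflation top_ses (chom_comp j i).
Proof.
move=> [D [p ip]] [F [q jq]].
have [|U nU|G [r jir]] := @quotient_exact k A C (chom_comp j i).
- by move=> x y /(te_inj jq)/(te_inj ip).
- have [O /(te_emb jq)[O' nO' O'O] OU] := te_emb ip nU.
  by exists O' => // x /O'O /OU.
have [|d dE] := te_descend ip (f := chom_comp r j).
  by move=> a; exact: (te_comp jir).
have [|g gE] := te_descend jir (f := q).
  by move=> a; exact: (te_comp jq).
have dg : top_exact d g.
  split=> [x y|z|U nU|z|O nO].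
  - have [b <-] := te_surj ip x; have [b' <-] := te_surj ip y.
    move=> /eqP; rewrite -subr_eq0 -!chomB dE => /eqP /(te_ker jir)[a].
    move=> /(te_inj jq) iab; apply/eqP; rewrite -subr_eq0 -chomB -iab.
    by rewrite (te_comp ip).
  - have [c <-] := te_surj jir z; rewrite gE; split=> [/(te_ker jq)[b <-]|].
      by exists (p b); rewrite dE.
    move=> [x]; have [b <-] := te_surj ip x; rewrite dE => rb.
    by rewrite -gE -rb gE (te_comp jq).
  - have [O /nbhs_opensub[O' O'O] OU] := te_emb jq (chom_nbhs p nU).
    exists (r @` O'); first exact: (te_open jir (opensub_nbhs O')).
    move=> x [c Oc]; have [b <-] := te_surj ip x; rewrite dE => /eqP.
    rewrite -subr_eq0 -chomB => /eqP /(te_ker jir)[a jia].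
    have /O'O/OU : (O' : set C) (j (b + i a)) by rewrite chomD [j (i a)]jia addrC subrK.
    by rewrite /= chomD (te_comp ip) addr0.
  - by have [c <-] := te_surj jq z; exists (r c); rewrite gE.
  - apply: filterS (te_open jq (chom_nbhs r nO)) => _ [c Oc <-].
    by exists (r c).
have [G' eG] := top_ses_extension dg; subst G.
by exists G', r.
Qed.

Lemma top_ses_deflation_comp A B C (p : chom A B) (q : chom B C) :
  deflation top_ses p -> deflation top_ses q -> deflation top_ses (chom_comp q p).
Proof.
move=> [A' [i ip]] [B' [j jq]]; apply: ker_topsc => [c|O nO].
  have [b <-] := te_surj jq c; have [a <-] := te_surj ip b.
  by exists a.
apply: filterS (te_open jq (te_open ip nO)) => _ [_ [a Oa <-] <-].
by exists a.
Qed.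

(** The pushout is the quotient of A' * B by the image of A under (f, - i); it is
    complete as an extension of the cokernel of i by A'. *)
Lemma top_ses_pushout A B A' (i : chom A B) (f : chom A A') :
  inflation top_ses i -> exists B' (i' : chom A' B') (f' : chom B B'),
    is_pushout i f i' f' /\ inflation top_ses i'.
Proof.
move=> [C [q iq]]; have [P [f1 [f2 prod]]] := product_topsc A' B.
have [m mE] := chom_subE (chom_zero A B) i.
have [n nE] := product_pair f m prod.
have [inl lE] := product_pair (chom_id A') (chom_zero A' B) prod.
have [inr rE] := product_pair (chom_zero B A') (chom_id B) prod.
have n1 a : f1 (n a) = f a by case: (nE a).
have n2 a : f2 (n a) = - i a by case: (nE a) => _ ->; rewrite mE /= sub0r.
have l1 a : f1 (inl a) = a by case: (lE a).
have l2 a : f2 (inl a) = 0 by case: (lE a).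
have r1 a : f1 (inr a) = 0 by case: (rE a).
have r2 a : f2 (inr a) = a by case: (rE a).
have [|U nU|G [r nr]] := @quotient_exact k A P n.
- move=> x y /(congr1 f2); rewrite !n2 => /oppr_inj; exact: (te_inj iq).
- have [O nO OU] := te_emb iq nU; have [O' O'O] := nbhs_opensub nO.
  exists (f2 @^-1` O'); first exact: chom_nbhs (opensub_nbhs O').
  move=> x /=; rewrite n2 => /(is_submodN (submodP O')).
  by rewrite opprK => /O'O /OU.
have [|g gE] := te_descend nr (f := chom_comp q f2).
  by move=> a; rewrite /= n2 -[- _]sub0r chomB chom0 sub0r (te_comp iq) oppr0.
rewrite /= in gE.
have ex : top_exact (chom_comp r inl) g.
  split=> [x y|z|U /nbhs_opensub[U' U'U]|z|O nO].
  - move=> /eqP; rewrite /= -subr_eq0 -!chomB => /eqP /(te_ker nr)[a na].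
    have := congr1 f2 na; rewrite n2 l2 => /eqP.
    rewrite oppr_eq0 -(chom0 i) => /eqP /(te_inj iq) a0.
    have := congr1 f1 na; rewrite n1 l1 a0 chom0 => /esym/eqP.
    by rewrite subr_eq0 => /eqP.
  - have [x <-] := te_surj nr z; rewrite gE; split=> [/(te_ker iq)[a ia]|[y yx]].
      exists (f1 x + f a); apply/eqP; rewrite /= -subr_eq0 -chomB.
      apply/eqP/(te_ker nr); exists a; apply: (prod_ext prod).
        by rewrite n1 chomB l1 addrAC subrr add0r.
      by rewrite n2 chomB l2 ia sub0r.
    by rewrite -gE -yx gE l2 chom0.
  - have [O /nbhs_opensub[W WO] OU] := te_emb iq (chom_nbhs f (opensub_nbhs U')).
    pose N := opensubI (opensub_preimage f1 U') (opensub_preimage f2 W).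
    exists (r @` N); first exact: (te_open nr (opensub_nbhs N)).
    move=> x [y [Uy Wy]] /eqP; rewrite /= eq_sym -subr_eq0 -chomB => /eqP.
    move=> /(te_ker nr)[a na].
    have := congr1 f2 na; rewrite n2 chomB l2 sub0r => /oppr_inj ia.
    have /OU Ua : O (i a) by apply: WO; rewrite ia.
    have := congr1 f1 na; rewrite n1 chomB l1 => fa; apply: U'U.
    rewrite -[x](subrK (f1 y)) -fa.
    exact: (is_submodD (submodP U')).
  - have [b <-] := te_surj iq z; have [x [_ xb]] := prod_ex prod 0 b.
    by exists (r x); rewrite gE xb.
  - have nO' := chom_nbhs inr (chom_nbhs r nO).
    apply: filterS (te_open iq nO') => _ [b Ob <-].
    by exists (r (inr b)); rewrite // gE r2.
have [G' eG] := top_ses_extension ex; subst G.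
exists G', (chom_comp r inl), (chom_comp r inr); split; last by exists C, g.
split=> [|X u v /chom_eq uv].
  apply: chomP => a; apply/eqP; rewrite /= -subr_eq0 -chomB.
  apply/eqP/(te_ker nr); exists a; apply: (prod_ext prod).
    by rewrite n1 chomB l1 r1 subr0.
  by rewrite n2 chomB l2 r2 sub0r.
rewrite /= in uv.
have [|w wE] := te_descend nr (f := chom_add (chom_comp u f1) (chom_comp v f2)).
  by move=> a; rewrite /= n1 n2 uv -[- i a]sub0r chomB chom0 sub0r subrr.
rewrite /= in wE; exists w; split.
  split; apply: chomP => x; rewrite /= wE ?l1 ?l2 ?r1 ?r2 chom0 ?addr0 ?add0r//.
move=> w' [/chom_eq w1 /chom_eq w2]; rewrite /= in w1 w2.
apply: chomP => z; have [x <-] := te_surj nr z; rewrite wE -w1 -w2 -!chomD.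
congr (w' (r _)); apply: (prod_ext prod); first by rewrite chomD l1 r1 addr0.
by rewrite chomD l2 r2 add0r.
Qed.

(** The pullback is the kernel of the difference map from B * C' to C, which is an
    open surjection because p is one. *)
Lemma top_ses_pullback B C C' (p : chom B C) (f : chom C' C) :
  deflation top_ses p -> exists B' (p' : chom B' C') (f' : chom B' B),
    is_pullback p f p' f' /\ deflation top_ses p'.
Proof.
move=> [A [i ip]]; have [P [f1 [f2 prod]]] := product_topsc B C'.
have [m mE] := chom_subE (chom_comp p f1) (chom_comp f f2).
rewrite /= in mE.
have [|O /(prod_nbhs prod)[O1 [O2 [n1 n2 OO]]]|K [j jm]] := @ker_topsc _ _ _ m.
- move=> c; have [b <-] := te_surj ip c; have [x [x1 x2]] := prod_ex prod b 0.
  by exists x; rewrite mE x1 x2 chom0 subr0.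
- apply: filterS (te_open ip n1) => _ [b Ob <-].
  have [x [x1 x2]] := prod_ex prod b 0.
  exists x; last by rewrite mE x1 x2 chom0 subr0.
  by apply: OO; rewrite ?x1 ?x2//; exact: nbhs_singleton n2.
have lift b c : p b = f c -> exists x, f1 (j x) = b /\ f2 (j x) = c.
  have [x [x1 x2]] := prod_ex prod b c => pf.
  have /(te_ker jm)[y yx] : m x = 0 by rewrite mE x1 x2 pf subrr.
  by exists y; rewrite yx.
exists K, (chom_comp f2 j), (chom_comp f1 j); split; last first.
  apply: ker_topsc => [c|U /(te_emb jm)[O nO OU]].
    have [b pb] := te_surj ip (f c); have [x [_ xc]] := lift _ _ pb.
    by exists x.
  have [O1 [O2 [n1 n2 OO]]] := prod_nbhs prod nO.
  apply: filterS (filterI n2 (chom_nbhs f (te_open ip n1))) => c [Oc [b Ob pb]].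
  have [x [x1 x2]] := lift _ _ pb; exists x => //.
  by apply: OU; apply: OO; rewrite ?x1 ?x2.
split=> [|X u v /chom_eq uv].
  apply: chomP => x; apply/esym/eqP; rewrite /= -subr_eq0 -mE.
  exact/eqP/(te_comp jm).
rewrite /= in uv; have [h hE] := product_pair v u prod.
have [|w wE] := te_factor jm (f := h).
  by move=> x; rewrite mE (hE x).1 (hE x).2 uv subrr.
exists w; split.
  by split; apply: chomP => x; rewrite /= wE; case: (hE x).
move=> w' [/chom_eq w1 /chom_eq w2]; rewrite /= in w1 w2.
apply: chomP => x; apply: (te_inj jm); rewrite wE; have [h1 h2] := hE x.
by apply: (prod_ext prod); rewrite ?h1 ?h2 ?w1 ?w2.
Qed.

Lemma top_ses_exact_structure : is_exact_structure top_ses.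
Proof.
split.
- exact: top_ses_kernel.
- exact: top_ses_cokernel.
- exact: top_ses_iso.
- exact: top_ses_inflation_id.
- exact: top_ses_deflation_id.
- exact: top_ses_inflation_comp.
- exact: top_ses_deflation_comp.
- exact: top_ses_pushout.
- exact: top_ses_pullback.
Qed.

End ExactStructure.

(** * Box direct sums of copies of the product space *)

Lemma fsum_seqE (M : nmodType) (X : choiceType) (S : set X) (F : X -> M) :
  finite_set S -> (forall x, ~ S x -> F x = 0) ->
  \sum_(x \in setT) F x = \sum_(x <- finmap.enum_fset (fset_set S)) F x.
Proof.
move=> fS F0; rewrite -fsbig_finite//; apply/esym/fsbig_widen => // x [_ Sx].
exact: F0.
Qed.

(** The big operator over an infinite set is zero by convention when the support
    is infinite, hence the need to restrict the three sums to a common finite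
    set. *)
Lemma fsum_linear (k : fieldType) (L M : lmodType k) (X : choiceType)
    (F : X -> L -> M) : (forall x, linear (F x)) ->
  (forall l, finite_set [set x | F x l <> 0]) ->
  linear (fun l => \sum_(x \in setT) F x l).
Proof.
move=> linF finF a u v.
pose S := [set x | F x u <> 0] `|` [set x | F x v <> 0].
have fS : finite_set S by rewrite finite_setU.
have u0 x : ~ S x -> F x u = 0 by move=> Sx; apply: contrapT => Fx; apply: Sx; left.
have v0 x : ~ S x -> F x v = 0 by move=> Sx; apply: contrapT => Fx; apply: Sx; right.
rewrite !(fsum_seqE fS)// => [|x Sx]; last first.
  by rewrite linF u0// v0// scaler0 addr0.
rewrite scaler_sumr -big_split; apply: eq_bigr => x _; exact: linF.
Qed.

Section SumSpace.
Variables (k : fieldType) (X : choiceType).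

Definition finsupp : set (X -> nat -> k^o) := [set b | finite_set [set x | b x <> 0]].

Lemma finsupp_submod : is_submod finsupp.
Proof.
split=> [|a b c fb fc]; rewrite /finsupp /=.
  by rewrite [X in finite_set X](_ : _ = set0)// -subset0 => x /=; apply.
apply: sub_finite_set (_ : _ `<=` [set x | b x <> 0] `|` [set x | c x <> 0]) _.
  move=> x /= bc; apply: contrapT => /not_orP[/contrapT b0 /contrapT c0].
  apply: bc; apply/funext => n; rewrite -[LHS]/(a * b x n + c x n) b0 c0.
  by rewrite -[LHS]/(a * 0 + 0) mulr0 addr0.
by rewrite finite_setU.
Qed.

Definition sumspace : Type := subm (Submod finsupp_submod).
HB.instance Definition _ := GRing.Lmodule.copy sumspace (subm (Submod finsupp_submod)).

(** Entries live in k rather than in k^o, so that ring lemmas apply to them. *)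
Definition entry (b : sumspace) : X -> nat -> k := \val b.

Lemma entry_ext (b c : sumspace) : (forall x n, entry b x n = entry c x n) -> b = c.
Proof. by move=> bc; apply: val_inj; apply/funext => x; apply/funext => n; exact: bc. Qed.

Lemma entryL a (b c : sumspace) x n :
  entry (a *: b + c) x n = a * entry b x n + entry c x n.
Proof. exact: (congr1 (fun f => f x n) (val_submL a b c)). Qed.

Lemma entryB (b c : sumspace) x n : entry (b - c) x n = entry b x n - entry c x n.
Proof. by rewrite addrC -scaleN1r entryL mulN1r addrC. Qed.

Lemma entry0 x n : entry 0 x n = 0.
Proof. by rewrite -(subrr 0) entryB subrr. Qed.

Lemma entry_finite (b : sumspace) : finite_set [set x | entry b x <> fun=> 0].
Proof. exact: (submP b). Qed.

Lemma sumspace_mk (f : X -> nat -> k) : finite_set [set x | f x <> fun=> 0] ->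
  exists b : sumspace, entry b = f.
Proof.
move=> hf; exists (@mksub _ _ (Submod finsupp_submod) f hf).
exact: (@val_mksub _ _ (Submod finsupp_submod) f hf).
Qed.

(** The depth g x is chosen for each x independently of the others: this is what
    makes the direct sum carry the box topology. *)
Definition box (g : X -> nat) : set sumspace :=
  [set b | forall x n, (n < g x)%N -> entry b x n = 0].

Lemma box_submod g : is_submod (box g).
Proof.
split=> [x n _|a b c hb hc x n nx]; first exact: entry0.
by rewrite entryL hb// hc// mulr0 addr0.
Qed.

Lemma box_base_submod A : range box A -> is_submod A.
Proof. by move=> [g _ <-]; exact: box_submod. Qed.

Lemma box_base_ex : exists A, range box A.
Proof. by exists (box (fun=> 0%N)); exists (fun=> 0%N). Qed.

Lemma box_baseI A A' : range box A -> range box A' ->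
  exists2 A'', range box A'' & A'' `<=` A `&` A'.
Proof.
move=> [g _ <-] [h _ <-]; exists (box (fun x => maxn (g x) (h x))); first by eexists.
move=> b hb; split=> x n nx; apply: hb; rewrite leq_max.
  by rewrite nx.
by rewrite nx orbT.
Qed.

HB.instance Definition _ := hasSubmodBase.Build k sumspace
  box_base_submod box_base_ex box_baseI.

Lemma nbhs_sumspace (A : set sumspace) :
  nbhs (0 : sumspace) A <-> exists g, box g `<=` A.
Proof.
split=> [[_ [g _ <-] gA]|[g gA]].
  by exists g => b /gA; rewrite add0r.
by exists (box g); [exists g|move=> b /gA; rewrite add0r].
Qed.

Definition box_opensub g : opensub sumspace :=
  nbhs_osub (box_submod g) ((nbhs_sumspace (box g)).2 (ex_intro _ g (fun _ h => h))).

Lemma sumspace_hausdorff : hausdorff sumspace.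
Proof.
move=> b hb; apply: entry_ext => x n.
by rewrite entry0; apply: (hb (box_opensub (fun=> n.+1)) x n).
Qed.

(** The limit is taken entrywise.  It has finite support: if f x <> 0 for
    infinitely many x, choose a nonzero entry m x in each of these rows; the
    approximation modulo a box deeper than m agrees with f at all the entries
    (x, m x), so it would have infinite support. *)
Lemma sumspace_cauchy_complete : cauchy_complete sumspace.
Proof.
move=> r hr.
pose c g := r (box_opensub g).
have cE g x n : (n < g x)%N -> entry (c g) x n = entry (c (fun=> n.+1)) x n.
  move=> nx; pose h y := maxn (g y) n.+1.
  have hE g' : (n < g' x)%N -> (forall y, g' y <= h y)%N ->
      entry (c h) x n = entry (c g') x n.
    move=> ng' g'h; apply/eqP; rewrite -subr_eq0 -entryB.
    apply/eqP; apply: (hr (box_opensub h) (box_opensub g')) => // b hb y m my.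
    by apply: hb; exact: leq_trans (g'h y).
  rewrite -(hE g)// => [|y]; last exact: leq_maxl.
  by apply: hE => // y; exact: leq_maxr.
pose f x n := entry (c (fun=> n.+1)) x n.
have /choice[m mP] x : exists n, f x <> (fun=> 0) -> f x n <> 0.
  have [fx|fx] := pselect (exists n, f x n <> 0).
    by have [n fn] := fx; exists n.
  exists 0%N => nf; exfalso; apply: nf; apply/funext => n.
  by apply: contrapT => fn; apply: fx; exists n.
have [|b bf] := @sumspace_mk f.
  apply: sub_finite_set (entry_finite (c (fun x => (m x).+1))) => x /= /mP fx cx.
  by apply: fx; rewrite /f -(cE (fun x => (m x).+1))// cx.
exists b => O; have [g gO] := (nbhs_sumspace O).1 (opensub_nbhs O).
have -> : b - r O = (b - c g) + (c g - r O) by rewrite subrKA.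
apply: (is_submodD (submodP O)).
  by apply: gO => x n nx; rewrite entryB bf cE// subrr.
by apply: hr => x; exact: gO.
Qed.

HB.instance Definition _ := isCompleteSeparated.Build k sumspace
  (hausdorff_separated sumspace_hausdorff)
  (cauchy_complete_complete sumspace_cauchy_complete).

Lemma delta_ex (y : X) (m : nat) : exists b : sumspace,
  forall x n, entry b x n = ((x == y) && (n == m))%:R.
Proof.
have [|b bE] := @sumspace_mk (fun x n => ((x == y) && (n == m))%:R).
  apply: sub_finite_set (finite_set1 y) => x /= hx; apply: contrapT => /eqP xy.
  by apply: hx; apply/funext => n; rewrite (negPf xy).
by exists b => x n; rewrite bE.
Qed.

Definition delta y m : sumspace := projT1 (cid (delta_ex y m)).

Lemma entry_delta y m x n : entry (delta y m) x n = ((x == y) && (n == m))%:R.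
Proof. exact: (projT2 (cid (delta_ex y m))). Qed.

End SumSpace.

(** * An open surjection that does not lift null sequences *)

Section SummationMap.
Variable k : fieldType.

(** A double sequence s indexes one summand k^N, sent to C by means of the rows of
    s. *)
Definition dseq : Type := nat -> nat -> k.
HB.instance Definition _ := Choice.copy dseq (nat -> nat -> k).

(** The space k^N with the product topology is the box sum with a single
    summand, so that its completeness need not be proved separately. *)
Definition pspace := sumspace k unit.

(** The m-th coordinate of the image of the j-th unit vector of summand s.
    Truncation in degrees below j^2 makes the rows tend to zero, fast enough for
    finitely many of them to span small subspaces only. *)
Definition weight (s : dseq) (j m : nat) : k := if (j * j <= m)%N then s j m else 0.

(** The sum stops at j = m, after which the weights vanish. *)
Definition psum_term (m : nat) (s : dseq) (b : sumspace k dseq) : k^o :=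
  \sum_(j < m.+1) entry b s j * weight s j m.

Definition psumval (b : sumspace k dseq) (m : nat) : k :=
  \sum_(s \in [set: dseq]) psum_term m s b.

Lemma psum_term_linear m s : linear (psum_term m s).
Proof.
move=> a b c; rewrite /psum_term scaler_sumr -big_split; apply: eq_bigr => j _.
by rewrite entryL mulrDl /GRing.scale /= mulrA.
Qed.

Lemma psum_term_finite m b : finite_set [set s | psum_term m s b <> 0].
Proof.
apply: sub_finite_set (entry_finite b) => s /= sb b0; apply: sb.
by rewrite /psum_term b0 big1// => j _; rewrite mul0r.
Qed.

Lemma psumval_linear m : linear (psumval^~ m : _ -> k^o).
Proof.
exact: fsum_linear (psum_term_linear m) (psum_term_finite m).
Qed.

Lemma weight_small s j m : (m < j)%N -> weight s j m = 0.
Proof.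
move=> mj; rewrite /weight leqNgt (leq_trans mj)// leq_pmulr//.
by rewrite (leq_trans _ mj).
Qed.

Lemma psum_term_widen N m s b : (m < N)%N ->
  psum_term m s b = \sum_(j < N) entry b s j * weight s j m.
Proof.
move=> mN; rewrite /psum_term.
rewrite -!(big_mkord xpredT (fun j => entry b s j * weight s j m)).
rewrite [RHS](@big_cat_nat _ _ _ m.+1)//= [X in _ = _ + X]big1_seq ?addr0//.
move=> j; rewrite mem_index_iota => /andP[_ /andP[mj _]].
by rewrite weight_small// mulr0.
Qed.

Lemma unit_fun_ex (c : nat -> k) : exists b : pspace, entry b tt = c.
Proof.
have [|b bE] := @sumspace_mk k unit (fun=> c); first exact: finite_finset.
by exists b; rewrite bE.
Qed.

Lemma psum_ex : exists p : chom (sumspace k dseq) pspace,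
  forall b m, entry (p b) tt m = psumval b m.
Proof.
have /choice[p pE] b := unit_fun_ex (psumval b).
have pE' b m : entry (p b) tt m = psumval b m by rewrite pE.
have lp : linear p.
  move=> a b c; apply: entry_ext => -[] m; rewrite entryL !pE'.
  exact: psumval_linear.
suff cp : continuous p by exists (CHom lp cp).
apply: (linear_nbhs0_continuous lp) => A /nbhs_sumspace[g gA].
apply/nbhs_sumspace; exists (fun=> g tt) => b hb; apply: gA => -[] m mg.
rewrite pE' /psumval fsbig1// => s _; rewrite /psum_term big1// => j _.
by rewrite hb ?mul0r// (leq_ltn_trans _ mg)// -ltnS.
Qed.

Definition psum : chom (sumspace k dseq) pspace := projT1 (cid psum_ex).

Lemma entry_psum b m : entry (psum b) tt m = psumval b m.
Proof. exact: (projT2 (cid psum_ex)). Qed.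

Lemma entry_psum_delta s j m : entry (psum (delta k s j)) tt m = weight s j m.
Proof.
rewrite entry_psum /psumval -(fsbig_widen [set s])//=; last first.
  move=> s' [_ ss'] /=; rewrite /psum_term big1// => i _.
  have /eqP/negPf sf : s' <> s by [].
  by rewrite entry_delta sf mul0r.
rewrite fsbig_set1 (@psum_term_widen (maxn m.+1 j.+1))// ?leq_max ?leqnn//.
have jN : (j < maxn m.+1 j.+1)%N by rewrite leq_max leqnn orbT.
rewrite (bigD1 (Ordinal jN))//= big1 ?addr0 => [|i ij].
  by rewrite entry_delta !eqxx mul1r.
rewrite entry_delta eqxx /=; case: eqP => [ij'|_]; last by rewrite mul0r.
by move: ij; rewrite -val_eqE /= ij' eqxx.
Qed.

Lemma psum_surjective c : exists b, psum b = c.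
Proof.
exists (delta k (fun _ m => entry c tt m) 0%N).
by apply: entry_ext => -[] m; rewrite entry_psum_delta.
Qed.

(** Argue by contradiction: collect counterexamples c N vanishing in degrees below
    N into a double sequence s whose j-th row is c (j^2), which truncation leaves
    unchanged.  The unit vector of summand s in degree g s belongs to the box of
    depth g and is sent to a counterexample. *)
Lemma psum_open (O : set (sumspace k dseq)) : nbhs (0 : sumspace k dseq) O ->
  nbhs (0 : pspace) (psum @` O).
Proof.
move=> /nbhs_sumspace[g gO]; apply/nbhs_sumspace; apply: contrapT => hN.
have /choice[c cP] N : exists c : pspace,
    (forall m, (m < N)%N -> entry c tt m = 0) /\ ~ (psum @` O) c.
  apply: contrapT => hc; apply: hN; exists (fun=> N) => c c0.
  by apply: contrapT => cO; apply: hc; exists c; split=> // m; exact: c0.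
pose s : dseq := fun j m => entry (c (j * j)%N) tt m.
have [c0 cO] := cP (g s * g s)%N; apply: cO; exists (delta k s (g s)).
  apply: gO => x n nx; rewrite entry_delta.
  by case: eqP => //= xs; case: eqP => //= ng; move: nx; rewrite ng xs ltnn.
apply: entry_ext => -[] m; rewrite entry_psum_delta /weight.
by case: leqP => // /c0 ->.
Qed.

Lemma psum_deflation : exists (A : topscType k) (i : chom A (sumspace k dseq)),
  top_ses i psum.
Proof. exact: ker_topsc psum_surjective psum_open. Qed.

End SummationMap.

(** * Series in a completion, linear dependence, independent sequences *)

Lemma linear_fun0 (k : fieldType) (L M : lmodType k) (f : L -> M) :
  linear f -> f 0 = 0.
Proof. by move=> lf; have := lf (-1) 0 0; rewrite scaler0 addr0 scaleN1r addNr. Qed.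

Lemma linear_funB (k : fieldType) (L M : lmodType k) (f : L -> M) a b :
  linear f -> f (a - b) = f a - f b.
Proof.
by move=> lf; have := lf (-1) b a; rewrite !scaleN1r [- b + a]addrC => ->; rewrite addrC.
Qed.

Section CompletionSeries.
Variables (k : fieldType) (T : linTopType k).

Lemma qproj_sum_eq (O : opensub T) (x : nat -> T) (M M' : nat) :
  (forall n, (M <= n)%N -> (O : set T) (x n)) ->
  (forall n, (M' <= n)%N -> (O : set T) (x n)) ->
  qproj O (\sum_(n < M) x n) = qproj O (\sum_(n < M') x n).
Proof.
wlog MM' : M M' / (M <= M')%N.
  move=> H hM hM'; have [/H|/ltnW/H h] := leqP M M'; first exact.
  by apply/esym/h.
move=> hM _; apply/esym/qprojP.
rewrite -!(big_mkord xpredT x) (big_cat_nat _ MM')//= addrAC subrr add0r big_seq.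
elim/big_ind: _ => [|u v|n]; first exact: opensub0.
  exact: is_submodD (submodP O).
by rewrite mem_index_iota => /andP[/hM].
Qed.

(** The partial sums going past the terms outside of O differ by elements of O,
    hence agree in the quotient by O: this is the component of the sum at O. *)
Lemma compl_series (x : nat -> T) :
  (forall O : opensub T, exists M, forall n, (M <= n)%N -> (O : set T) (x n)) ->
  exists z : completion T, forall (O : opensub T) M,
    (forall n, (M <= n)%N -> (O : set T) (x n)) ->
    cproj z O = qproj O (\sum_(n < M) x n).
Proof.
move=> /choice[M hM].
have hc (O O' : opensub T) : O `<=` O' ->
    quot_map idfun O' (qproj O (\sum_(n < M O) x n)) =
    qproj O' (\sum_(n < M O') x n).
  move=> OO'; rewrite quot_map_id//; apply: qproj_sum_eq; last exact: hM.
  by move=> n Mn; apply: OO'; exact: hM.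
exists (Completion hc) => O N hN; apply: qproj_sum_eq => //; exact: hM.
Qed.

(** A linear map extends to y by evaluation at an approximation of y, as soon as
    it vanishes on some open subspace; the value does not depend on which one. *)
Lemma linear_approx (W : lmodType k) (f : T -> W) (y : completion T)
    (O O' : opensub T) : linear f ->
  (forall t, (O : set T) t -> f t = 0) -> (forall t, (O' : set T) t -> f t = 0) ->
  f (qrepr (cproj y O)) = f (qrepr (cproj y O')).
Proof.
move=> lf fO fO'.
have sub (P Q : opensub T) : P `<=` Q -> (forall t, (Q : set T) t -> f t = 0) ->
    f (qrepr (cproj y P)) = f (qrepr (cproj y Q)).
  move=> PQ fQ; apply/eqP; rewrite -subr_eq0 -(linear_funB _ _ lf); apply/eqP/fQ/qprojP.
  by rewrite [RHS]qreprK -(cproj_compat y PQ) -[in RHS](qreprK (cproj y P)) quot_map_id.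
pose I := opensubI O O'.
by rewrite -(sub I O)// -?(sub I O')// => x [].
Qed.

End CompletionSeries.

Lemma linear_dependence (k : fieldType) (fs : seq (nat -> k)) (N : nat) :
  (size fs < N)%N -> exists a : nat -> k,
    (exists2 m, (m < N)%N & a m <> 0) /\
    forall f, f \in fs -> \sum_(m < N) a m * f m = 0.
Proof.
move=> hN; pose A := \matrix_(m < N, i < size fs) (nth (fun=> 0) fs i : nat -> k) m.
have rA : kermx A != 0.
  rewrite kermx_eq0 /row_free neq_ltn; apply/orP; left.
  by rewrite (leq_ltn_trans (rank_leq_col A)).
have /rowV0Pn[u uA u0] := rA.
have /sub_kermxP uA0 := uA.
pose a m := if insub m is Some i then u 0 i else 0.
have aE (i : 'I_N) : a i = u 0 i by rewrite /a insubT//= => ?; congr (u _ _); exact: val_inj.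
exists a; split.
  have /rV0Pn[i ui] := u0; exists (val i); first exact: ltn_ord.
  by rewrite aE; apply/eqP.
move=> f /(nthP (fun=> 0))[i ifs <-].
have /matrixP/(_ 0 (Ordinal ifs)) := uA0; rewrite !mxE => uA0i.
by rewrite -[RHS]uA0i; apply: eq_bigr => m _; rewrite aE !mxE.
Qed.

Definition indep (k : fieldType) (V : lmodType k) (v : nat -> V) :=
  forall N (a : nat -> k), \sum_(n < N) a n *: v n = 0 ->
  forall n, (n < N)%N -> a n = 0.

Lemma indep_ex (k : fieldType) (V : lmodType k) : ~ finite_dim V ->
  exists v : nat -> V, indep v.
Proof.
move=> nV.
have /choice[f hf] (s : seq V) : exists x, ~ Defs.span [set x | x \in s] x.
  apply: contrapT => hs; apply: nV; exists s; apply/seteqP; split=> // x _.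
  by apply: contrapT => hx; apply: hs; exists x.
pose s n := iter n (fun s => rcons s (f s)) [::].
have sn i n : (i < n)%N -> f (s i) \in s n.
  elim: n => // n IH; rewrite ltnS leq_eqVlt /= mem_rcons in_cons.
  by move=> /predU1P[->|/IH ->]; rewrite ?eqxx ?orbT.
exists (fun n => f (s n)); elim=> [//|N IH] a.
rewrite big_ord_recr /= => sum0.
have aN : a N = 0.
  apply/eqP/negPn/negP => aN0; apply: (hf (s N)).
  have sp := span_submod [set x | x \in s N].
  have -> : f (s N) = - (a N)^-1 *: (\sum_(n < N) a n *: f (s n)).
    rewrite (eqP (_ : \sum_(n < N) a n *: f (s n) == - (a N *: f (s N)))).
      by rewrite scaleNr scalerN opprK scalerA mulVf// scale1r.
    by rewrite -addr_eq0 sum0.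
  apply: (is_submodZ _ sp); elim/big_ind: _ => [|x y|n _]; first exact: sp.1.
    exact: is_submodD.
  by apply: (is_submodZ _ sp); apply: Defs.sub_span; apply: sn.
move: sum0; rewrite aN scale0r addr0 => /IH aa n.
by rewrite ltnS leq_eqVlt => /predU1P[->//|]; exact: aa.
Qed.

(** * Completed tensor products with a discrete space *)

(** The common features of the two tensor topologies when V is discrete.  The
    universal property is stated for maps to V only, the target of all the
    contractions used below. *)
Record discrete_tensor (k : fieldType) (U : linTopType k) (V : lmodType k)
    (T : linTopType k) (t : U -> V -> T) : Prop := DiscreteTensor {
  dt_ind : forall P : set T, is_submod P -> (forall u v, P (t u v)) -> forall x, P x;
  dt_lift : forall b : U -> V -> V, (forall v, linear (b^~ v)) ->
    (forall u, linear (b u)) ->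
    exists2 f : T -> V, linear f & forall u v, f (t u v) = b u v;
  dt_nbhs : forall E : set T, is_submod E -> (nbhs (0 : T) E <->
    exists2 P : set U, nbhs (0 : U) P & forall u v, P u -> E (t u v)) }.

Section DiscreteTensor.
Variables (k : fieldType) (U : linTopType k) (V : linTopType k).
Hypothesis discV : is_discrete V.

Lemma submod0 : is_submod [set (0 : V)].
Proof. by split=> // a _ _ -> ->; rewrite scaler0 addr0. Qed.

Lemma tensor_left_discrete :
  @discrete_tensor k U V (tensor_left U V) (@tens k U V).
Proof.
split.
- exact: tensor_ind.
- move=> b bl br; exists (tensor_lift b); first exact: tensor_lift_linear.
  exact: tensor_liftE.
- move=> E sE; split.
    move=> /(nbhs0_open sE)/(open_tensor_left sE)[_ [P [sP oP PE]] _].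
    exists P; first by apply: open_nbhs_nbhs; split=> //; exact: sP.1.
    by move=> u v Pu; apply: PE; apply: Defs.sub_span; exists u => //; exists v.
  move=> [P /nbhs_opensub[O OP] PE].
  apply: open_nbhs_nbhs; split; last exact: sE.1.
  apply/(open_tensor_left sE); split=> //.
    exists O; split; [exact: submodP|exact: opensub_open|].
    by move=> x; apply=> // _ [u Ou [v _ <-]]; exact/PE/OP.
  move=> u; exists [set (0 : V)]; split=> [||_ ->]; first exact: submod0.
    exact: discV.
  by rewrite linear0; exact: sE.1.
Qed.

Lemma tensor_shriek_discrete :
  @discrete_tensor k U V (tensor_shriek U V) (@tens k U V).
Proof.
split.
- exact: tensor_ind.
- move=> b bl br; exists (tensor_lift b); first exact: tensor_lift_linear.
  exact: tensor_liftE.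
- move=> E sE; split.
    move=> /(nbhs0_open sE)/(open_tensor_shriek sE)[_ [P [Q [sP oP sQ oQ PE]]]].
    exists P; first by apply: open_nbhs_nbhs; split=> //; exact: sP.1.
    move=> u v Pu; apply: PE; exists (tens u v).
      by apply: Defs.sub_span; exists u => //; exists v.
    by exists 0; [exact: (Defs.span_submod _).1|exact: addr0].
  move=> [P /nbhs_opensub[O OP] PE].
  apply: open_nbhs_nbhs; split; last exact: sE.1.
  apply/(open_tensor_shriek sE); split=> //.
  exists O, [set (0 : V)]; split.
  - exact: submodP.
  - exact: opensub_open.
  - exact: submod0.
  - exact: discV.
  move=> _ [x hx [y hy <-]]; apply: (is_submodD sE).
    by apply: hx => // _ [u Ou [v _ <-]]; exact/PE/OP.
  by apply: hy => // _ [u _ [_ -> <-]]; rewrite linear0; exact: sE.1.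
Qed.

End DiscreteTensor.

Section FiniteSupport.
Variables (k : fieldType) (X : choiceType) (V : lmodType k) (T : linTopType k).
Variable t : sumspace k X -> V -> T.
Hypothesis dt : discrete_tensor t.

Lemma slice_ex : exists q : X -> nat -> T -> V,
  (forall x n, linear (q x n)) /\
  forall x n b v, q x n (t b v) = entry b x n *: v.
Proof.
have /choice[q qP] (x : X) : exists q : nat -> T -> V, forall n,
    linear (q n) /\ forall b v, q n (t b v) = entry b x n *: v.
  have /choice[q qP] n : exists q : T -> V,
      linear q /\ forall b v, q (t b v) = entry b x n *: v.
    have [||f lf fE] := dt_lift dt (b := fun b v => entry b x n *: v).
    - by move=> v a b c; rewrite entryL scalerDl scalerA.
    - by move=> b a u v; rewrite scalerDr !scalerA mulrC.
    by exists f.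
  by exists q.
by exists q; split=> [x n|x n]; case: (qP x n).
Qed.

Definition slice := projT1 (cid slice_ex).

Lemma slice_linear x n : linear (slice x n).
Proof. by have [] := projT2 (cid slice_ex). Qed.

Lemma sliceE x n b v : slice x n (t b v) = entry b x n *: v.
Proof. by have [] := projT2 (cid slice_ex). Qed.

Lemma slice0 x n : slice x n 0 = 0.
Proof. exact: linear_fun0 (slice_linear x n). Qed.

Lemma slice_finite s : finite_set [set x | exists n, slice x n s <> 0].
Proof.
pose P := [set s : T | finite_set [set x | exists n, slice x n s <> 0]].
apply: (dt_ind dt (P := P)) => [|b v]; rewrite /P /=.
  split=> [|a s1 s2 f1 f2] /=.
    rewrite [Y in finite_set Y](_ : _ = set0)// -subset0 => x [n] /=.
    by rewrite slice0.
  apply: sub_finite_set (_ : _ `<=` [set x | exists n, slice x n s1 <> 0] `|`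
    [set x | exists n, slice x n s2 <> 0]) _; last by rewrite finite_setU.
  move=> x [n]; rewrite slice_linear => sn.
  apply: contrapT => /not_orP[s10 s20]; apply: sn.
  have [-> ->] : slice x n s1 = 0 /\ slice x n s2 = 0.
    by split; apply: contrapT => h; [apply: s10|apply: s20]; exists n.
  by rewrite scaler0 addr0.
apply: sub_finite_set (entry_finite b) => x [n] /=; rewrite sliceE => bn b0.
by apply: bn; rewrite b0 scale0r.
Qed.

Lemma slicebox_submod (g : X -> nat) :
  is_submod [set s | forall x n, (n < g x)%N -> slice x n s = 0].
Proof.
split=> [x n _|a s1 s2 h1 h2 x n nx]; first exact: slice0.
by rewrite slice_linear h1// h2// scaler0 addr0.
Qed.

Lemma slicebox_nbhs (g : X -> nat) :
  nbhs (0 : T) [set s | forall x n, (n < g x)%N -> slice x n s = 0].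
Proof.
apply/(dt_nbhs dt); first exact: slicebox_submod.
exists (box g); first by apply/nbhs_sumspace; exists g.
by move=> b v hb x n nx; rewrite sliceE hb// scale0r.
Qed.

Definition slicebox g : opensub T := nbhs_osub (slicebox_submod g) (slicebox_nbhs g).

(** Choose m x such that the slice (x, m x) of y is nonzero whenever some slice
    (x, n) is.  The tensors whose slices (x, n) with n <= m x all vanish form an
    open subspace; modulo it y is represented by a tensor, all whose slices
    outside of a finite set of x vanish. *)
Lemma completion_finite_support (y : completion T) :
  exists2 S : set X, finite_set S & forall (g : X -> nat) x n,
    ~ S x -> (n < g x)%N -> slice x n (qrepr (cproj y (slicebox g))) = 0.
Proof.
pose val x n := slice x n (qrepr (cproj y (slicebox (fun=> n.+1)))).
have valE g x n : (n < g x)%N ->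
    slice x n (qrepr (cproj y (slicebox g))) = val x n.
  move=> nx; apply: linear_approx; first exact: slice_linear.
    by move=> s hs; exact: hs.
  by move=> s hs; exact: hs.
have /choice[m mP] (x : X) : exists m, forall n, val x n <> 0 -> val x m <> 0.
  have [[m hm]|hx] := pselect (exists n, val x n <> 0); first by exists m.
  by exists 0%N => n hn; exfalso; apply: hx; exists n.
exists [set x | exists n, slice x n (qrepr (cproj y (slicebox (fun x => (m x).+1)))) <> 0].
  exact: slice_finite.
move=> g x n Sx nx; rewrite valE//; apply: contrapT => /mP vm.
by apply: Sx; exists (m x); rewrite valE.
Qed.

End FiniteSupport.

Section NotSurjective.
Variables (k : fieldType) (V : lmodType k) (TB TC : linTopType k).
Variables (tB : sumspace k (dseq k) -> V -> TB) (tC : pspace k -> V -> TC).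
Hypotheses (dB : discrete_tensor tB) (dC : discrete_tensor tC).
Variable h : chom TB TC.
Hypothesis hE : forall b v, h (tB b v) = tC (psum k b) v.

(** For N = (r + 1)^2 with r the size of S, the rows j > r vanish in degrees below
    N, which leaves r (r + 1) < N linear conditions on N coefficients. *)
Lemma annihilator (S : seq (dseq k)) : exists (N : nat) (a : nat -> k),
  (exists2 m, (m < N)%N & a m <> 0) /\
  forall s j, s \in S -> \sum_(m < N) a m * weight s j m = 0.
Proof.
pose r := size S; pose N := (r.+1 * r.+1)%N.
pose fs := [seq (weight s j : nat -> k) | s <- S, j <- iota 0 r.+1].
have [|a [a0 afs]] := @linear_dependence k fs N.
  by rewrite size_allpairs size_iota ltn_pmul2r.
exists N, a; split=> // s j sS; have [jr|rj] := ltnP j r.+1.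
  by apply: afs; apply/allpairsP; exists (s, j); split=> //; rewrite mem_iota.
rewrite big1// => m _; rewrite /weight leqNgt (leq_trans (ltn_ord m)) ?mulr0//.
exact: leq_mul.
Qed.

(** Expresses what the functional a of C sees of the image of a tensor through the
    slices of this tensor, which are controlled by the finiteness of the support
    on one side and by the annihilator on the other. *)
Lemma weighted_slices N (a : nat -> k) (f : TC -> V) : linear f ->
  (forall c v, f (tC c v) = (\sum_(m < N) a m * entry c tt m) *: v) ->
  forall s, f (h s) = \sum_(x \in [set: dseq k])
    \sum_(j < N) (\sum_(m < N) a m * weight x j m) *: slice dB x j s.
Proof.
move=> lf fE; pose F (x : dseq k) s : V :=
  \sum_(j < N) (\sum_(m < N) a m * weight x j m) *: slice dB x j s.
have lF x : linear (F x).
  move=> c s1 s2; rewrite /F scaler_sumr -big_split; apply: eq_bigr => j _ /=.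
  by rewrite slice_linear scalerDr !scalerA [c * _]mulrC.
have finF s : finite_set [set x | F x s <> 0].
  apply: sub_finite_set (slice_finite dB s) => x /= Fx; apply: contrapT => sx.
  apply: Fx; rewrite /F big1// => j _; rewrite (_ : slice _ _ _ _ = 0) ?scaler0//.
  by apply: contrapT => sj; apply: sx; exists j.
have lsum := fsum_linear lF finF.
apply: (dt_ind dB (P := [set s | f (h s) = \sum_(x \in setT) F x s])).
  split=> [|c s1 s2] /=.
    by rewrite (linear_fun0 lsum) chom0 (linear_fun0 lf).
  by rewrite chomL lf lsum => -> ->.
move=> b v /=; rewrite hE fE.
pose S := [set x | entry b x <> fun=> 0].
have fS : finite_set S := entry_finite b.
have b0 x j : ~ S x -> entry b x j = 0.
  by move=> /contrapT ->.
rewrite (fsum_seqE fS) => [|x Sx]; last first.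
  by rewrite /F big1// => j _; rewrite sliceE b0// scale0r scaler0.
under [RHS]eq_bigr => x _ do
  (rewrite /F; under eq_bigr => j _ do rewrite sliceE scalerA).
under [RHS]eq_bigr => x _ do rewrite -scaler_suml.
rewrite -scaler_suml; congr (_ *: v).
transitivity (\sum_(m < N) \sum_(x <- finmap.enum_fset (fset_set S))
    \sum_(j < N) a m * (entry b x j * weight x j m)).
  apply: eq_bigr => m _; rewrite entry_psum /psumval (fsum_seqE fS) => [|x Sx].
    by rewrite mulr_sumr; apply: eq_bigr => x _; rewrite (@psum_term_widen _ N)// mulr_sumr.
  by rewrite /psum_term big1// => j _; rewrite b0// mul0r.
rewrite exchange_big; apply: eq_bigr => x _ /=.
rewrite exchange_big; apply: eq_bigr => j _ /=.
by rewrite mulr_suml; apply: eq_bigr => m _; rewrite mulrCA mulrC.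
Qed.

Lemma compl_map_not_surjective (v : nat -> V) : indep v ->
  exists z : completion TC, forall y : completion TB, compl_map h y <> z.
Proof.
move=> iv; pose e n : pspace k := delta k tt n.
have [O|z zE] := @compl_series k TC (fun n => tC (e n) (v n)).
  have /(dt_nbhs dC (submodP O))[P /nbhs_sumspace[g gP] PO] := opensub_nbhs O.
  exists (g tt) => n gn; apply: PO; apply: gP => -[] m mg.
  by rewrite entry_delta eqxx /=; case: eqP => // mn; rewrite mn ltnNge gn in mg.
exists z => y yz.
have [S fS yS] := completion_finite_support dB y.
have [N [a [[m0 m0N a0] aS]]] := annihilator (finmap.enum_fset (fset_set S)).
have [||f lf fE] := dt_lift dC (b := fun c v => (\sum_(m < N) a m * entry c tt m) *: v).
- move=> u c c1 c2; rewrite scalerA -scalerDl mulr_sumr -big_split; congr (_ *: u).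
  by apply: eq_bigr => m _; rewrite entryL /= mulrDr mulrCA.
- by move=> c b u1 u2; rewrite scalerDr !scalerA mulrC.
have f0 := linear_fun0 lf.
have sK : is_submod [set s | f s = 0].
  by split=> [//|c s1 s2] /=; rewrite lf => -> ->; rewrite scaler0 addr0.
have nK : nbhs (0 : TC) [set s | f s = 0].
  apply/(dt_nbhs dC sK); exists (box (fun=> N)).
    by apply/nbhs_sumspace; exists (fun=> N).
  move=> c u hc; rewrite /= fE big1 ?scale0r// => m _.
  by rewrite hc ?mulr0// ltn_ord.
(* The functional sees y only through its slices of degree below N, and the
   series only through its first N terms. *)
pose K := nbhs_osub sK nK; pose O := slicebox dB (fun=> N).
have fhE := weighted_slices lf fE.
have OK : O `<=` h @^-1` K.
  move=> s hs; rewrite /= fhE fsbig1// => x _; rewrite big1// => j _.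
  by rewrite hs ?scaler0.
have := congr1 (fun z => cproj z K) yz.
rewrite (compl_mapE y OK) (zE K N) => [|n Nn]; last first.
  rewrite /= fE big1 ?scale0r// => m _.
  by rewrite entry_delta eqxx; case: eqP => /= [mn|_]; [rewrite -mn leqNgt ltn_ord in Nn|rewrite mulr0].
rewrite -[cproj y O]qreprK quot_mapE// => /qprojP /=.
set s := qrepr _; set w := \sum_(n < N) _ => fsw.
have : f (h s) = f w.
  by apply/eqP; rewrite -subr_eq0 -(linear_funB _ _ lf) fsw.
rewrite fhE fsbig1 => [|x _]; last first.
  rewrite big1// => j _; have [xS|xS] := pselect (S x).
    by rewrite aS ?scale0r// in_fset_set// inE.
  by rewrite yS ?scaler0.
have -> : f w = \sum_(n < N) a n *: v n.
  rewrite /w (big_morph f (id1 := 0) (op1 := +%R)) => [|s1 s2|//]; last first.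
    by have := lf 1 s1 s2; rewrite !scale1r.
  apply: eq_bigr => n _; rewrite fE (bigD1 n)//= big1 ?addr0 => [|m mn].
    by rewrite entry_delta !eqxx mulr1.
  rewrite entry_delta eqxx; case: eqP => mn'; rewrite ?mulr0//=.
  by move: mn; rewrite -val_eqE /= mn' eqxx.
by move=> /esym/iv/(_ _ m0N).
Qed.

End NotSurjective.

(** * Deflations are surjective *)

Section Deflations.
Variable k : fieldType.

(** The unit vector e_0 is sent to an arbitrary vector z: k^N is used in place of
    the discrete line k. *)
Lemma pspace_hom_ex (C : linTopType k) (z : C) :
  exists f : chom (pspace k) C, forall c, f c = entry c tt 0%N *: z.
Proof.
have lf : linear (fun c : pspace k => entry c tt 0%N *: z).
  by move=> a c d; rewrite entryL scalerDl scalerA.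
suff cf : continuous (fun c : pspace k => entry c tt 0%N *: z).
  by exists (CHom lf cf).
apply: (linear_nbhs0_continuous lf) => A nA; apply/nbhs_sumspace.
exists (fun=> 1%N) => c hc /=; rewrite hc// scale0r.
exact: nbhs_singleton nA.
Qed.

(** Pull p back along a map f with f e_0 = c to a deflation p'.  If some p' b has a
    nonzero entry in degree 0, dividing by it gives a preimage of c.  Otherwise
    p' is killed by the nonzero projection g of k^N onto the line of e_0, which
    contradicts the uniqueness of factorizations through the cokernel p'. *)
Lemma deflation_surjective (E : ses_class k) (B C : topscType k) (p : chom B C) :
  is_exact_structure E -> deflation E p -> forall c, exists b, p b = c.
Proof.
move=> exE dp c; have [f fE] := pspace_hom_ex c.
have [B' [p' [f' [[/chom_eq sq _] [A' [i' ip']]]]]] := deflation_pullback exE f dp.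
apply: contrapT => hc.
have p'0 b : entry (p' b) tt 0%N = 0.
  apply: contrapT => /eqP b0; apply: hc.
  exists ((entry (p' b) tt 0%N)^-1 *: f' b).
  have /= := sq b; rewrite fE => pf.
  by rewrite [p _]linearZ /= -pf scalerA mulVf// scale1r.
have [g gE] := pspace_hom_ex (delta k tt 0%N).
have [comp0 univ] := ses_cokernel exE ip'.
have [|u [_ uniq]] := univ _ (chom_zero B' (pspace k)); first exact: chomP.
have g0 : g = chom_zero (pspace k) (pspace k).
  rewrite -(uniq g); last by apply: chomP => b /=; rewrite gE p'0 scale0r.
  by apply: uniq; apply: chomP => b.
have := congr1 (fun x : chom _ _ => entry (x (delta k tt 0%N)) tt 0%N) g0.
rewrite gE entry_delta eqxx scale1r entry_delta eqxx /= => /eqP.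
by rewrite entry0 oner_eq0.
Qed.

Lemma exact_functor_surjective (E : ses_class k) (F : scFunctor k) :
  is_maximal_exact_structure E -> is_exact_functor E F ->
  forall z, exists y, Defs.fmap F (psum k) y = z.
Proof.
move=> [exE maxE] exF; apply: (deflation_surjective exE).
have [A [i ip]] := psum_deflation k.
have Eip : E _ _ _ i (psum k) := maxE _ (top_ses_exact_structure k) _ _ _ _ _ ip.
by exists (F A), (Defs.fmap F i); exact: exF.
Qed.

End Deflations.

Theorem corollary13p9 (k : fieldType) :
  (forall V : linTopType k, is_discrete V -> ~ finite_dim V ->
     forall E : ses_class k, is_maximal_exact_structure E ->
       ~ is_exact_functor E (ctensor_left V)) /\
  (forall V : linTopType k, is_discrete V -> ~ finite_dim V ->
     forall E : ses_class k, is_maximal_exact_structure E ->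
       ~ is_exact_functor E (ctensor_shriek V)).
Proof.
split=> V dV /indep_ex[v iv] E maxE /(exact_functor_surjective maxE).
- have [|z hz] := compl_map_not_surjective
    (tensor_left_discrete (sumspace k (dseq k)) dV)
    (tensor_left_discrete (pspace k) dV)
    (h := tensor_left_map (psum k) (chom_id V)) _ iv.
    by move=> b u; exact: tensor_mapE.
  by move=> /(_ z)[y /hz].
- have [|z hz] := compl_map_not_surjective
    (tensor_shriek_discrete (sumspace k (dseq k)) dV)
    (tensor_shriek_discrete (pspace k) dV)
    (h := tensor_shriek_map (psum k) (chom_id V)) _ iv.
    by move=> b u; exact: tensor_mapE.
  by move=> /(_ z)[y /hz].
Qed.
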